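(* Let $\mathcal{M}'_m$ (resp. $\mathcal{M}''_m$) be a meridian surface of elliptic (resp. hyperbolic) type in $\mathbb{R}^4_1$ from the general class. (i) $\mathcal{M}'_m$ is a Chen surface if and only if the curve $c$ on $S^2(1)$ has constant spherical curvature $\kappa=\mathrm{const}=b$, $b\neq0$, and the meridian $m$ is determined by $\dot f=y(f)$, where $$y(t)=\frac{\pm1}{2\,t^{\pm1}}\sqrt{4\,t^{\pm2}-a\left(t^{\pm2}-\frac{b^2}{a}\right)^2},\qquad a=\mathrm{const}\neq0,$$ and $g(u)$ is defined by $\dot g(u)=\sqrt{\dot f^2(u)-1}$. (ii) $\mathcal{M}''_m$ is a Chen surface if and only if the curve $c$ on $S^2_1(1)$ has constant spherical curvature $\kappa=\mathrm{const}=b$, $b\neq0$, and the meridian $m$ is determined by $\dot f=y(f)$, where $$y(t)=\frac{\pm1}{2\,t^{\pm1}}\sqrt{4\,t^{\pm2}+a\left(t^{\pm2}-\frac{b^2}{a}\right)^2},\qquad a=\mathrm{const}\neq0,$$ and $g(u)$ is defined by $\dot g(u)=\sqrt{1-\dot f^2(u)}$.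
   Context: $\mathbb{R}^4_1$ is Minkowski 4-space with metric $\langle\cdot,\cdot\rangle$ of signature $(3,1)$ and orthonormal basis $e_1,e_2,e_3,e_4$, $\langle e_i,e_i\rangle=1$ for $i=1,2,3$, $\langle e_4,e_4\rangle=-1$. Dots denote $d/du$; $I,J\subset\mathbb{R}$ are intervals; all functions are smooth. Meridian surface of elliptic type: $\mathcal{M}'_m: z(u,v)=f(u)\,l(v)+g(u)\,e_4$, $u\in I$, $v\in J$, where $f>0$, $\dot f^2-\dot g^2=1$, and $c: l=l(v)$ is a smooth curve parameterized by arc length ($\langle l',l'\rangle=1$) on the unit sphere $S^2(1)$ centered at the origin of the Euclidean space $\mathrm{span}\{e_1,e_2,e_3\}$. Put $t=l'$ and let $n$ be a smooth unit vector field with $\{l,t,n\}$ an orthonormal frame of $\mathrm{span}\{e_1,e_2,e_3\}$; the spherical curvature of $c$ is $\kappa(v)=\langle t'(v),n(v)\rangle$. Meridian surface of hyperbolic type: $\mathcal{M}''_m: z(u,v)=f(u)\,l(v)+g(u)\,e_1$, $u\in I$, $v\in J$, where $f>0$, $\dot f^2+\dot g^2=1$, and $c: l=l(v)$ is a smooth curve with $\langle l',l'\rangle=1$ on the de Sitter space $S^2_1(1)=\{V:\langle V,V\rangle=1\}$ in $\mathrm{span}\{e_2,e_3,e_4\}$. Put $t=l'$ and let $n$ be a smooth vector field with $\langle n,n\rangle=-1$ and $\{l,t,n\}$ an orthonormal frame of $\mathrm{span}\{e_2,e_3,e_4\}$; the spherical curvature of $c$ is $\kappa(v)=\langle t'(v),n(v)\rangle$.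 Both are spacelike surfaces (the induced metric is Riemannian). The curve $m:u\mapsto(f(u),g(u))$ is the meridian curve, with curvature $\kappa_m=\dot f\ddot g-\dot g\ddot f$. The sign of $\dot g$ is normalized so that $\dot g=\sqrt{\dot f^2-1}$ in the elliptic case and $\dot g=\sqrt{1-\dot f^2}$ in the hyperbolic case. The surface is from the general class if $\kappa_m(u)\,\kappa(v)\neq0$ for all $u,v$. It is also assumed that the mean curvature vector field $H=\frac12\mathrm{tr}\,\sigma$ ($\sigma$ the second fundamental tensor) satisfies $\langle H,H\rangle\neq0$ everywhere. Chen surface: let $\{b,l\}$ be an orthonormal frame of the normal bundle with $b$ collinear with $H$ (here $b,l$ are normal vector fields, not the constant $b$ and curve $l(v)$ above), and let $A_b,A_l$ be the corresponding shape operators. The allied mean curvature vector field is $a(H)=\frac{\|H\|}{2}\,\mathrm{tr}(A_bA_l)\,l$, where $\|H\|=\sqrt{|\langle H,H\rangle|}$. The surface is a Chen surface if $a(H)$ vanishes identically. For the surfaces considered this is equivalent to the vanishing of the invariant $\lambda=\langle\nabla'_xy,b\rangle$, where $\nabla'$ is the flat connection of $\mathbb{R}^4_1$, $x=(X+Y)/\sqrt2$, $y=(-X+Y)/\sqrt2$, $X=z_u$, $Y=z_v/f$. ''Determined by $\dot f=y(f)$'' means $\dot f(u)=y(f(u))$. In a formula with several $\pm$ signs, the upper signs or the lower signs are taken together.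
   Formalization: In (ii) the equation for the derivative of f is required on each subinterval of I where that derivative has no zero, with sign and constant a depending on the subinterval; with a single sign and a on all of I the ''only if'' fails when the derivative of f changes sign. *)

(* Defs.v *)
From Stdlib Require Import Reals ZArith.
From Coquelicot Require Import Coquelicot.
Open Scope R_scope.

Definition interval (I : R -> Prop) : Prop :=
  (forall x y s, I x -> I y -> x <= s <= y -> I s) /\
  (exists x y, I x /\ I y /\ x < y).

(** At an end point belonging to [I], [f] is the restriction of a function that
    is smooth on both sides; its derivatives there are determined by [f] on [I]
    because [I] is nondegenerate. *)
Definition smooth_on (I : R -> Prop) (f : R -> R) : Prop :=
  forall u, I u -> locally u (fun x => forall k, ex_derive_n f k x).

(** * Minkowski space of signature (3,1) *)

Definition R41 : Type := (R * R * R * R)%type.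

Definition x1 (w : R41) : R := fst (fst (fst w)).
Definition x2 (w : R41) : R := snd (fst (fst w)).
Definition x3 (w : R41) : R := snd (fst w).
Definition x4 (w : R41) : R := snd w.

Definition e1 : R41 := (1, 0, 0, 0).
Definition e4 : R41 := (0, 0, 0, 1).

Definition mink (w w' : R41) : R :=
  x1 w * x1 w' + x2 w * x2 w' + x3 w * x3 w' - x4 w * x4 w'.

Definition Dcurve (w : R -> R41) (s : R) : R41 :=
  (Derive (fun r => x1 (w r)) s, Derive (fun r => x2 (w r)) s,
   Derive (fun r => x3 (w r)) s, Derive (fun r => x4 (w r)) s).

Definition smooth_curve_on (J : R -> Prop) (w : R -> R41) : Prop :=
  smooth_on J (fun v => x1 (w v)) /\ smooth_on J (fun v => x2 (w v)) /\
  smooth_on J (fun v => x3 (w v)) /\ smooth_on J (fun v => x4 (w v)).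

(** * Extrinsic geometry of a parametrized spacelike surface [z(u,v)]

    Tensors are given by their components in the coordinate frame
    (index 0 for [u], index 1 for [v]). *)

Definition pd (i : nat) (z : R -> R -> R41) (u v : R) : R41 :=
  match i with
  | O => Dcurve (fun s => z s v) u
  | _ => Dcurve (fun s => z u s) v
  end.

Definition metric (z : R -> R -> R41) (u v : R) : matrix 2 2 :=
  mk_matrix 2 2 (fun i j => mink (pd i z u v) (pd j z u v)).

Definition det2 (M : matrix 2 2) : R :=
  coeff_mat 0 M 0 0 * coeff_mat 0 M 1 1 - coeff_mat 0 M 0 1 * coeff_mat 0 M 1 0.

Definition inv2 (M : matrix 2 2) : matrix 2 2 :=
  mk_matrix 2 2 (fun i j =>
    (match i, j with
     | O, O => coeff_mat 0 M 1 1
     | O, _ => - coeff_mat 0 M 0 1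
     | _, O => - coeff_mat 0 M 1 0
     | _, _ => coeff_mat 0 M 0 0
     end) / det2 M).

Definition tr2 (M : matrix 2 2) : R := coeff_mat 0 M 0 0 + coeff_mat 0 M 1 1.

Definition metric_inv (z : R -> R -> R41) (u v : R) (i j : nat) : R :=
  coeff_mat 0 (inv2 (metric z u v)) i j.

Definition tangential_part (z : R -> R -> R41) (u v : R) (w : R41) : R41 :=
  sum_n (fun i => sum_n (fun j =>
    scal (metric_inv z u v i j * mink w (pd j z u v)) (pd i z u v)) 1) 1.

Definition normal_part (z : R -> R -> R41) (u v : R) (w : R41) : R41 :=
  minus w (tangential_part z u v w).

(** [sigma (d_i, d_j)], the normal part of the flat derivative of [z_j] along [z_i]. *)
Definition second_form (z : R -> R -> R41) (i j : nat) (u v : R) : R41 :=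
  normal_part z u v (pd i (pd j z) u v).

Definition mean_curvature (z : R -> R -> R41) (u v : R) : R41 :=
  scal (1 / 2) (sum_n (fun i => sum_n (fun j =>
    scal (metric_inv z u v i j) (second_form z i j u v)) 1) 1).

(** The operator with [<A_nu X, Y> = <sigma (X, Y), nu>]. *)
Definition shape_operator (z : R -> R -> R41) (nu : R41) (u v : R) : matrix 2 2 :=
  Mmult (inv2 (metric z u v))
        (mk_matrix 2 2 (fun i j => mink (second_form z i j u v) nu)).

Definition pseudo_norm (w : R41) : R := sqrt (Rabs (mink w w)).

(** [{b, l}] is an orthonormal frame of the normal plane at [(u, v)], and [b] is
    collinear with the mean curvature vector.  The normal plane is Lorentzian,
    so one of the two vectors is timelike. *)
Definition adapted_normal_frame
    (z : R -> R -> R41) (b l : R41) (u v : R) : Prop :=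
  mink b (pd 0 z u v) = 0 /\ mink b (pd 1 z u v) = 0 /\
  mink l (pd 0 z u v) = 0 /\ mink l (pd 1 z u v) = 0 /\
  mink b l = 0 /\ Rabs (mink b b) = 1 /\ Rabs (mink l l) = 1 /\
  (exists k : R, mean_curvature z u v = scal k b).

Definition allied_mean_curvature
    (z : R -> R -> R41) (b l : R41) (u v : R) : R41 :=
  scal (pseudo_norm (mean_curvature z u v) / 2 *
        tr2 (Mmult (shape_operator z b u v) (shape_operator z l u v))) l.

(** Where [H] is not null, [b] and [l] are determined up to sign, so the
    vanishing of [a(H)] does not depend on the frame; [a(H)] involves no
    derivative of [b] and [l], so no regularity of the frame is needed. *)
Definition Chen_surface (I J : R -> Prop) (z : R -> R -> R41) : Prop :=
  exists b l : R -> R -> R41, forall u v, I u -> J v ->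
    adapted_normal_frame z (b u v) (l u v) u v /\
    allied_mean_curvature z (b u v) (l u v) u v = zero.

(** * Meridian surfaces *)

Definition elliptic_meridian_surface (f g : R -> R) (l : R -> R41) (u v : R) : R41 :=
  plus (scal (f u) (l v)) (scal (g u) e4).

Definition hyperbolic_meridian_surface (f g : R -> R) (l : R -> R41) (u v : R) : R41 :=
  plus (scal (f u) (l v)) (scal (g u) e1).

Definition meridian_curvature (f g : R -> R) (u : R) : R :=
  Derive f u * Derive_n g 2 u - Derive g u * Derive_n f 2 u.

Definition spherical_curvature (l n : R -> R41) (v : R) : R :=
  mink (Dcurve (Dcurve l) v) (n v).

Record elliptic_data (I J : R -> Prop) (f g : R -> R) (l n : R -> R41) : Prop := {
  ell_I : interval I;
  ell_J : interval J;
  ell_f_smooth : smooth_on I f;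
  ell_g_smooth : smooth_on I g;
  ell_f_pos : forall u, I u -> 0 < f u;
  ell_arclength : forall u, I u -> Derive f u ^ 2 - Derive g u ^ 2 = 1;
  ell_g_sign : forall u, I u -> Derive g u = sqrt (Derive f u ^ 2 - 1);
  ell_l_smooth : smooth_curve_on J l;
  ell_n_smooth : smooth_curve_on J n;
  ell_l_span : forall v, J v -> x4 (l v) = 0;
  ell_n_span : forall v, J v -> x4 (n v) = 0;
  ell_ll : forall v, J v -> mink (l v) (l v) = 1;
  ell_tt : forall v, J v -> mink (Dcurve l v) (Dcurve l v) = 1;
  ell_nn : forall v, J v -> mink (n v) (n v) = 1;
  ell_ln : forall v, J v -> mink (l v) (n v) = 0;
  ell_tn : forall v, J v -> mink (Dcurve l v) (n v) = 0
}.

Record hyperbolic_data (I J : R -> Prop) (f g : R -> R) (l n : R -> R41) : Prop := {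
  hyp_I : interval I;
  hyp_J : interval J;
  hyp_f_smooth : smooth_on I f;
  hyp_g_smooth : smooth_on I g;
  hyp_f_pos : forall u, I u -> 0 < f u;
  hyp_arclength : forall u, I u -> Derive f u ^ 2 + Derive g u ^ 2 = 1;
  hyp_g_sign : forall u, I u -> Derive g u = sqrt (1 - Derive f u ^ 2);
  hyp_l_smooth : smooth_curve_on J l;
  hyp_n_smooth : smooth_curve_on J n;
  hyp_l_span : forall v, J v -> x1 (l v) = 0;
  hyp_n_span : forall v, J v -> x1 (n v) = 0;
  hyp_ll : forall v, J v -> mink (l v) (l v) = 1;
  hyp_tt : forall v, J v -> mink (Dcurve l v) (Dcurve l v) = 1;
  hyp_nn : forall v, J v -> mink (n v) (n v) = -1;
  hyp_ln : forall v, J v -> mink (l v) (n v) = 0;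
  hyp_tn : forall v, J v -> mink (Dcurve l v) (n v) = 0
}.

Definition general_class (I J : R -> Prop) (f g : R -> R) (l n : R -> R41) : Prop :=
  forall u v, I u -> J v ->
    meridian_curvature f g u * spherical_curvature l n v <> 0.

Definition non_null_mean_curvature (I J : R -> Prop) (z : R -> R -> R41) : Prop :=
  forall u v, I u -> J v ->
    mink (mean_curvature z u v) (mean_curvature z u v) <> 0.

(** [eps] is [1] for the upper signs and [-1] for the lower ones.  Outside its
    domain the square root is [0]; wherever [f' = y f] and [f' <> 0] hold, the
    radicand is positive. *)
Definition y_elliptic (eps : Z) (a b t : R) : R :=
  IZR eps / (2 * powerRZ t eps) *
  sqrt (4 * powerRZ t (2 * eps) - a * (powerRZ t (2 * eps) - b ^ 2 / a) ^ 2).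

Definition y_hyperbolic (eps : Z) (a b t : R) : R :=
  IZR eps / (2 * powerRZ t eps) *
  sqrt (4 * powerRZ t (2 * eps) + a * (powerRZ t (2 * eps) - b ^ 2 / a) ^ 2).

Definition meridian_determined_by
    (y : Z -> R -> R -> R -> R) (b : R) (K : R -> Prop) (f : R -> R) : Prop :=
  exists (eps : Z) (a : R), (eps = 1 \/ eps = -1)%Z /\ a <> 0 /\
    forall u, K u -> Derive f u = y eps a b (f u).

(** For a meridian of hyperbolic type [f'] may change sign (then [f] has a strict
    extremum), whereas each function [y] has a constant sign; so the equation is
    required, with its own sign and constant [a], on every subinterval of [I]
    on which [f'] has no zero.  If [f'] has no zero in [I], this is
    [meridian_determined_by y b I f]. *)
Definition meridian_piecewise_determined_by
    (y : Z -> R -> R -> R -> R) (b : R) (I : R -> Prop) (f : R -> R) : Prop :=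
  forall K : R -> Prop, interval K -> (forall u, K u -> I u) ->
    (forall u, K u -> Derive f u <> 0) ->
    meridian_determined_by y b K f.

(* Main.v *)
Require Import Defs.
From Stdlib Require Import Reals ZArith Lra Psatz.
From Coquelicot Require Import Coquelicot.
Open Scope R_scope.

(** Both types of surfaces are [z = f l + g e] with an orthonormal frame
    [l, t, n, e], where [<n,n> = s], [<e,e> = - s] and [f'^2 - s g'^2 = 1]; the
    elliptic case is [s = 1] and the hyperbolic case [s = -1].  All arguments are
    carried out for both at once.

    The normal plane is spanned by [n] and by the unit normal of the meridian,
    and all shape operators are diagonal in the coordinates [(u, v)]
    ([meridian_second_derivatives]).  Computing [tr (A_b A_l)] in this basis gives
    a product in which only one factor can vanish for a surface from the general
    class, so that the surface is a Chen surface if and only if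
    [g'^2 = (f kappa_m)^2 + kappa^2] for all [u] and [v] ([meridian_Chen_iff]).
    Separating the variables, this means that [kappa] is a constant [b] and that
    [g'^2 - (f kappa_m)^2 = b^2] along the meridian
    ([Chen_constant_spherical_curvature]).

    The latter is a differential equation of second order for the meridian.
    With the Frenet equations [f'' = s kappa_m g'] and [g'' = kappa_m f'], its
    derivative says that [f kappa_m + g'] is a constant multiple [C f] of [f].
    Since [b^2 = (g' + f kappa_m) (g' - f kappa_m)], this gives the first integral
    [2 g' = C f + b^2 / (C f)] ([Chen_meridian_first_integral]), and
    differentiating the first integral leads back to the equation wherever
    [f' <> 0] ([first_integral_Chen_meridian]).  Finally [f'^2 = 1 + s g'^2] turns
    the first integral into [f' = y(f)], with [a = - C^2] for the upper signs and
    [a = - b^4 / C^2] for the lower signs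
    ([meridian_slope_iff_first_integral]).  In the elliptic case [f'] has no zero;
    in the hyperbolic case its zeros are isolated, and the equation extends to
    them by continuity ([Chen_meridian_of_nonzero_slope]). *)

(** * Functions on an interval *)

Lemma smooth_on_ex_derive_n I f u k : smooth_on I f -> I u -> ex_derive_n f k u.
Proof. intros Hf Iu. exact (locally_singleton _ _ (Hf u Iu) k). Qed.

Lemma smooth_on_locally_ex_derive I f u :
  smooth_on I f -> I u -> locally u (fun x => ex_derive f x).
Proof.
  intros Hf Iu. apply filter_imp with (2 := Hf u Iu). intros x Hx. exact (Hx 1%nat).
Qed.

Lemma interval_near I u d :
  interval I -> I u -> 0 < d -> exists k, k <> 0 /\ Rabs k < d /\ I (u + k).
Proof.
  intros [Hconv (x0 & y0 & Ix0 & Iy0 & Hxy)] Iu Hd.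
  destruct (Rlt_dec u y0) as [Huy | Huy].
  - exists (Rmin (d / 2) (y0 - u)).
    assert (0 < Rmin (d / 2) (y0 - u)) by (apply Rmin_pos; lra).
    pose proof (Rmin_l (d / 2) (y0 - u)). pose proof (Rmin_r (d / 2) (y0 - u)).
    split; [lra|]. split; [rewrite Rabs_pos_eq; lra|].
    apply Hconv with u y0; auto; lra.
  - exists (- Rmin (d / 2) (u - x0)).
    assert (0 < Rmin (d / 2) (u - x0)) by (apply Rmin_pos; lra).
    pose proof (Rmin_l (d / 2) (u - x0)). pose proof (Rmin_r (d / 2) (u - x0)).
    split; [lra|]. split; [rewrite Rabs_Ropp, Rabs_pos_eq; lra|].
    apply Hconv with x0 u; auto; lra.
Qed.

Lemma interval_neighbourhood I u d :
  interval I -> I u -> 0 < d -> interval (fun x => I x /\ Rabs (x - u) < d).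
Proof.
  intros HI Iu Hd. split.
  - intros x y t [Ix Hx] [Iy Hy] Ht. split; [apply HI with x y; assumption|].
    apply Rabs_def2 in Hx, Hy. apply Rabs_def1; lra.
  - destruct (interval_near I u d HI Iu Hd) as (k & Hk0 & Hkd & Ik).
    assert (Hu : I u /\ Rabs (u - u) < d) by (split; [|rewrite Rminus_diag, Rabs_R0]; auto).
    assert (Huk : I (u + k) /\ Rabs (u + k - u) < d)
      by (split; [|replace (u + k - u) with k by ring]; auto).
    destruct (Rlt_dec 0 k) as [Hk | Hk].
    + exists u, (u + k). repeat split; try tauto; lra.
    + exists (u + k), u. repeat split; try tauto; lra.
Qed.

(** At an end point of [I] the hypothesis is one-sided, but difference quotients
    from one side suffice to determine the derivative. *)
Lemma is_derive_of_constant_on I h c u d :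
  interval I -> (forall x, I x -> h x = c) -> I u -> is_derive h u d -> d = 0.
Proof.
  intros HI Hc Iu Hd.
  destruct (Req_dec d 0) as [|Hd0]; [assumption | exfalso].
  apply is_derive_Reals in Hd.
  assert (Hdp : 0 < Rabs d) by (apply Rabs_pos_lt; assumption).
  destruct (Hd (Rabs d) Hdp) as [delta Hdelta].
  destruct (interval_near I u delta HI Iu (cond_pos delta)) as (k & Hk0 & Hkd & Ik).
  specialize (Hdelta k Hk0 Hkd). rewrite (Hc _ Ik), (Hc _ Iu) in Hdelta.
  replace ((c - c) / k - d) with (- d) in Hdelta by (field; assumption).
  rewrite Rabs_Ropp in Hdelta. lra.
Qed.

Lemma ex_derive_near_neq (h : R -> R) c u :
  ex_derive h u -> h u <> c -> exists d, 0 < d /\ forall x, Rabs (x - u) < d -> h x <> c.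
Proof.
  intros Hh Hc.
  destruct (ex_derive_continuous h u Hh _ (open_neq c (h u) Hc)) as [d Hd].
  exists d. split; [apply cond_pos|]. exact Hd.
Qed.

Lemma simple_zero_isolated (h : R -> R) u h1 :
  is_derive h u h1 -> h u = 0 -> h1 <> 0 ->
  exists d, 0 < d /\ forall k, k <> 0 -> Rabs k < d -> h (u + k) <> 0.
Proof.
  intros Hh Hu H1. apply is_derive_Reals in Hh.
  destruct (Hh (Rabs h1) (Rabs_pos_lt _ H1)) as [d Hd].
  exists d. split; [apply cond_pos|]. intros k Hk Hkd E.
  specialize (Hd k Hk Hkd). rewrite E, Hu in Hd.
  replace ((0 - 0) / k - h1) with (- h1) in Hd by (field; assumption).
  rewrite Rabs_Ropp in Hd. lra.
Qed.

Lemma is_derive_zero_constant I (h : R -> R) u v :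
  interval I -> (forall x, I x -> is_derive h x 0) -> I u -> I v -> h u = h v.
Proof.
  intros [Hconv _] Hh Iu Iv.
  destruct (Rtotal_order u v) as [Huv | [-> | Huv]]; [ | reflexivity | symmetry].
  - apply (eq_is_derive (V := R_NormedModule) h u v); [|assumption].
    intros t Ht. apply Hh, Hconv with u v; assumption.
  - apply (eq_is_derive (V := R_NormedModule) h v u); [|assumption].
    intros t Ht. apply Hh, Hconv with v u; assumption.
Qed.

Lemma nonvanishing_constant_sign K (h : R -> R) :
  interval K -> (forall x, K x -> ex_derive h x) -> (forall x, K x -> h x <> 0) ->
  (forall x, K x -> 0 < h x) \/ (forall x, K x -> h x < 0).
Proof.
  intros [Hconv (x0 & _ & Kx0 & _)] Hd Hnz.
  assert (Hcont : forall x, K x -> continuity_pt h x).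
  { intros x Kx. apply continuity_pt_filterlim.
    exact (ex_derive_continuous h x (Hd x Kx)). }
  (* A change of sign between two points gives a zero between them. *)
  assert (Hivt : forall k : R, k <> 0 -> forall x y, K x -> K y -> x < y ->
            k * h x < 0 -> 0 < k * h y -> False).
  { intros k Hk x y Kx Ky Hxy Hx Hy.
    destruct (Ranalysis5.IVT_interv (fun t => k * h t) x y) as (z & Hz & Hz0); auto.
    - intros t Ht. apply continuity_pt_scal, Hcont, Hconv with x y; assumption.
    - apply (Hnz z); [apply Hconv with x y; assumption|]. nra. }
  pose proof (Hnz x0 Kx0) as H0.
  destruct (Rlt_dec 0 (h x0)) as [Hp | Hp]; [left | right]; intros x Kx;
    pose proof (Hnz x Kx); destruct (Rtotal_order x0 x) as [Hl | [<- | Hl]]; try lra;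
    apply Rnot_le_lt; intros Hn.
  - apply (Hivt (-1)) with x0 x; auto; lra.
  - apply (Hivt 1) with x x0; auto; lra.
  - apply (Hivt 1) with x0 x; auto; lra.
  - apply (Hivt (-1)) with x x0; auto; lra.
Qed.

(** * Minkowski space *)

Lemma R41_ext (a b : R41) :
  x1 a = x1 b -> x2 a = x2 b -> x3 a = x3 b -> x4 a = x4 b -> a = b.
Proof.
  destruct a as [[[a1 a2] a3] a4], b as [[[b1 b2] b3] b4].
  unfold x1, x2, x3, x4; cbn. congruence.
Qed.

Lemma mink_sym a b : mink a b = mink b a.
Proof. unfold mink. ring. Qed.

Lemma mink_plus_l (a b c : R41) : mink (plus a b) c = mink a c + mink b c.
Proof.
  change (mink (plus a b) c) with
    ((x1 a + x1 b) * x1 c + (x2 a + x2 b) * x2 c + (x3 a + x3 b) * x3 c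
     - (x4 a + x4 b) * x4 c).
  unfold mink. ring.
Qed.

Lemma mink_scal_l (k : R) (a c : R41) : mink (scal k a) c = k * mink a c.
Proof.
  change (mink (scal k a) c) with
    ((k * x1 a) * x1 c + (k * x2 a) * x2 c + (k * x3 a) * x3 c - (k * x4 a) * x4 c).
  unfold mink. ring.
Qed.

Lemma mink_minus_l (a b c : R41) : mink (minus a b) c = mink a c - mink b c.
Proof.
  change (mink (minus a b) c) with
    ((x1 a + - x1 b) * x1 c + (x2 a + - x2 b) * x2 c + (x3 a + - x3 b) * x3 c
     - (x4 a + - x4 b) * x4 c).
  unfold mink. ring.
Qed.

Lemma mink_plus_r (a b c : R41) : mink c (plus a b) = mink c a + mink c b.
Proof. rewrite mink_sym, mink_plus_l, (mink_sym a), (mink_sym b). reflexivity. Qed.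

Lemma mink_scal_r (k : R) (a c : R41) : mink c (scal k a) = k * mink c a.
Proof. rewrite mink_sym, mink_scal_l, (mink_sym a). reflexivity. Qed.

Lemma scal_R41_eq_zero (k : R) (a : R41) : scal k a = zero -> mink a a <> 0 -> k = 0.
Proof.
  intros H Ha.
  assert (E : k * mink a a = 0).
  { rewrite <- mink_scal_l, H. unfold mink, x1, x2, x3, x4. cbn. ring. }
  apply Rmult_integral in E. tauto.
Qed.

Definition det3 (a1 a2 a3 b1 b2 b3 c1 c2 c3 : R) : R :=
  a1 * (b2 * c3 - b3 * c2) - a2 * (b1 * c3 - b3 * c1) + a3 * (b1 * c2 - b2 * c1).

Definition det4 (a1 a2 a3 a4 b1 b2 b3 b4 c1 c2 c3 c4 d1 d2 d3 d4 : R) : R :=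
  a1 * det3 b2 b3 b4 c2 c3 c4 d2 d3 d4 - a2 * det3 b1 b3 b4 c1 c3 c4 d1 d3 d4
  + a3 * det3 b1 b2 b4 c1 c2 c4 d1 d2 d4 - a4 * det3 b1 b2 b3 c1 c2 c3 d1 d2 d3.

Definition volume (a b c d : R41) : R :=
  det4 (x1 a) (x2 a) (x3 a) (x4 a) (x1 b) (x2 b) (x3 b) (x4 b)
       (x1 c) (x2 c) (x3 c) (x4 c) (x1 d) (x2 d) (x3 d) (x4 d).

Definition gram (a b c d a' b' c' d' : R41) : R :=
  det4 (mink a a') (mink a b') (mink a c') (mink a d')
       (mink b a') (mink b b') (mink b c') (mink b d')
       (mink c a') (mink c b') (mink c c') (mink c d')
       (mink d a') (mink d b') (mink d c') (mink d d').

(** Multiplicativity of the determinant; the sign is the determinant of the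
    metric. *)
Lemma gram_volume a b c d a' b' c' d' :
  gram a b c d a' b' c' d' = - volume a b c d * volume a' b' c' d'.
Proof.
  destruct a as [[[? ?] ?] ?], b as [[[? ?] ?] ?], c as [[[? ?] ?] ?], d as [[[? ?] ?] ?].
  destruct a' as [[[? ?] ?] ?], b' as [[[? ?] ?] ?], c' as [[[? ?] ?] ?],
    d' as [[[? ?] ?] ?].
  unfold gram, volume, det4, det3, mink, x1, x2, x3, x4; cbn [fst snd]. ring.
Qed.

(** [s] is the sign of the third vector; the last one has the opposite sign, so
    [s = 1] and [s = -1] are the two positions of the timelike vector that
    occur for the two types of meridian surfaces. *)
Record orthonormal_frame (s : R) (l t n e : R41) : Prop := {
  frame_s : s * s = 1;
  frame_ll : mink l l = 1;
  frame_tt : mink t t = 1;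
  frame_nn : mink n n = s;
  frame_ee : mink e e = - s;
  frame_lt : mink l t = 0;
  frame_ln : mink l n = 0;
  frame_le : mink l e = 0;
  frame_tn : mink t n = 0;
  frame_te : mink t e = 0;
  frame_ne : mink n e = 0
}.

(** With [d] as first column the Gram determinant vanishes for any other three
    columns; since the frame spans a nonzero volume, so does every volume
    containing [d], among them those with three coordinate vectors, which are
    the components of [d]. *)
Lemma orthogonal_to_frame_eq_zero s l t n e d :
  orthonormal_frame s l t n e ->
  mink l d = 0 -> mink t d = 0 -> mink n d = 0 -> mink e d = 0 ->
  x1 d = 0 /\ x2 d = 0 /\ x3 d = 0 /\ x4 d = 0.
Proof.
  intros F Hl Ht Hn He.
  assert (Hvol : volume l t n e * volume l t n e = 1).
  { pose proof (gram_volume l t n e l t n e) as G.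
    unfold gram in G.
    rewrite (mink_sym t l), (mink_sym n l), (mink_sym n t), (mink_sym e l),
      (mink_sym e t), (mink_sym e n) in G.
    rewrite (frame_ll _ _ _ _ _ F), (frame_tt _ _ _ _ _ F), (frame_nn _ _ _ _ _ F),
      (frame_ee _ _ _ _ _ F), (frame_lt _ _ _ _ _ F), (frame_ln _ _ _ _ _ F),
      (frame_le _ _ _ _ _ F), (frame_tn _ _ _ _ _ F), (frame_te _ _ _ _ _ F),
      (frame_ne _ _ _ _ _ F) in G.
    pose proof (frame_s _ _ _ _ _ F). unfold det4, det3 in G. nra. }
  assert (Hz : forall b c a, volume d b c a = 0).
  { intros b c a. pose proof (gram_volume l t n e d b c a) as G.
    unfold gram in G. rewrite Hl, Ht, Hn, He in G. unfold det4, det3 in G.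
    assert (E : volume l t n e * volume d b c a = 0) by lra.
    apply Rmult_integral in E. destruct E as [E | E]; [|assumption].
    rewrite E in Hvol. lra. }
  pose proof (Hz (0, 1, 0, 0) (0, 0, 1, 0) (0, 0, 0, 1)) as H1.
  pose proof (Hz (1, 0, 0, 0) (0, 0, 1, 0) (0, 0, 0, 1)) as H2.
  pose proof (Hz (1, 0, 0, 0) (0, 1, 0, 0) (0, 0, 0, 1)) as H3.
  pose proof (Hz (1, 0, 0, 0) (0, 1, 0, 0) (0, 0, 1, 0)) as H4.
  destruct d as [[[d1 d2] d3] d4].
  unfold volume, det4, det3, x1, x2, x3, x4 in *. cbn [fst snd] in *. lra.
Qed.

(** The difference between [a] and its expansion in the frame is orthogonal to
    the frame. *)
Lemma parseval s l t n e a b :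
  orthonormal_frame s l t n e ->
  mink a b = mink l a * mink l b + mink t a * mink t b
             + s * (mink n a * mink n b) - s * (mink e a * mink e b).
Proof.
  intros F.
  set (r := minus a (plus (plus (scal (mink l a) l) (scal (mink t a) t))
              (plus (scal (s * mink n a) n) (scal (- s * mink e a) e)))).
  assert (Hr : forall w, mink w r = mink w a - (mink l a * mink w l + mink t a * mink w t
                 + (s * mink n a * mink w n + - s * mink e a * mink w e))).
  { intros w. unfold r.
    rewrite mink_sym, mink_minus_l, !mink_plus_l, !mink_scal_l.
    rewrite (mink_sym a), (mink_sym l w), (mink_sym t w), (mink_sym n w), (mink_sym e w).
    reflexivity. }
  pose proof (frame_s _ _ _ _ _ F) as Hs.
  destruct (orthogonal_to_frame_eq_zero s l t n e r F) as (R1 & R2 & R3 & R4).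
  1-4: rewrite Hr, ?(mink_sym t l), ?(mink_sym n l), ?(mink_sym n t), ?(mink_sym e l),
      ?(mink_sym e t), ?(mink_sym e n),
      ?(frame_ll _ _ _ _ _ F), ?(frame_tt _ _ _ _ _ F), ?(frame_nn _ _ _ _ _ F),
      ?(frame_ee _ _ _ _ _ F), ?(frame_lt _ _ _ _ _ F), ?(frame_ln _ _ _ _ _ F),
      ?(frame_le _ _ _ _ _ F), ?(frame_tn _ _ _ _ _ F), ?(frame_te _ _ _ _ _ F),
      ?(frame_ne _ _ _ _ _ F).
  - ring.
  - ring.
  - transitivity (mink n a * (1 - s * s)); [ring | rewrite Hs; ring].
  - transitivity (mink e a * (1 - s * s)); [ring | rewrite Hs; ring].
  - assert (Hb : mink b r = 0) by (unfold mink; rewrite R1, R2, R3, R4; ring).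
    rewrite Hr, (mink_sym b a), (mink_sym b l), (mink_sym b t), (mink_sym b n),
      (mink_sym b e) in Hb.
    lra.
Qed.

(** * Derivatives of curves *)

Definition differentiable_curve (w : R -> R41) (v : R) : Prop :=
  ex_derive (fun r => x1 (w r)) v /\ ex_derive (fun r => x2 (w r)) v /\
  ex_derive (fun r => x3 (w r)) v /\ ex_derive (fun r => x4 (w r)) v.

Lemma smooth_curve_differentiable J w v :
  smooth_curve_on J w -> J v ->
  differentiable_curve w v /\ differentiable_curve (Dcurve w) v /\
  differentiable_curve (Dcurve (Dcurve w)) v.
Proof.
  intros (H1 & H2 & H3 & H4) Jv.
  pose proof (fun k => smooth_on_ex_derive_n _ _ v k H1 Jv) as D1.
  pose proof (fun k => smooth_on_ex_derive_n _ _ v k H2 Jv) as D2.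
  pose proof (fun k => smooth_on_ex_derive_n _ _ v k H3 Jv) as D3.
  pose proof (fun k => smooth_on_ex_derive_n _ _ v k H4 Jv) as D4.
  split; [|split].
  - exact (conj (D1 1%nat) (conj (D2 1%nat) (conj (D3 1%nat) (D4 1%nat)))).
  - exact (conj (D1 2%nat) (conj (D2 2%nat) (conj (D3 2%nat) (D4 2%nat)))).
  - exact (conj (D1 3%nat) (conj (D2 3%nat) (conj (D3 3%nat) (D4 3%nat)))).
Qed.

Lemma smooth_curve_locally_differentiable J w v :
  smooth_curve_on J w -> J v -> locally v (differentiable_curve w).
Proof.
  intros (H1 & H2 & H3 & H4) Jv.
  apply filter_and; [exact (smooth_on_locally_ex_derive _ _ _ H1 Jv)|].
  apply filter_and; [exact (smooth_on_locally_ex_derive _ _ _ H2 Jv)|].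
  apply filter_and; [exact (smooth_on_locally_ex_derive _ _ _ H3 Jv)|].
  exact (smooth_on_locally_ex_derive _ _ _ H4 Jv).
Qed.

Lemma differentiable_curve_const (c : R41) v : differentiable_curve (fun _ => c) v.
Proof. repeat split; apply ex_derive_const. Qed.

Lemma Dcurve_const (c : R41) v : Dcurve (fun _ => c) v = zero.
Proof. unfold Dcurve. rewrite !Derive_const. reflexivity. Qed.

Lemma mink_zero_r a : mink a zero = 0.
Proof. unfold mink, x1, x2, x3, x4. cbn. ring. Qed.

Lemma is_derive_mink (a b : R -> R41) v :
  differentiable_curve a v -> differentiable_curve b v ->
  is_derive (fun r => mink (a r) (b r)) v
    (mink (Dcurve a v) (b v) + mink (a v) (Dcurve b v)).
Proof.
  intros (A1 & A2 & A3 & A4) (B1 & B2 & B3 & B4).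
  apply Derive_correct in A1, A2, A3, A4, B1, B2, B3, B4.
  pose proof (is_derive_mult _ _ _ _ _ A1 B1 Rmult_comm) as M1.
  pose proof (is_derive_mult _ _ _ _ _ A2 B2 Rmult_comm) as M2.
  pose proof (is_derive_mult _ _ _ _ _ A3 B3 Rmult_comm) as M3.
  pose proof (is_derive_mult _ _ _ _ _ A4 B4 Rmult_comm) as M4.
  pose proof (is_derive_minus _ _ _ _ _
    (is_derive_plus _ _ _ _ _ (is_derive_plus _ _ _ _ _ M1 M2) M3) M4) as M.
  evar_last; [exact M|].
  unfold mink, Dcurve, minus, plus, mult, opp, x1, x2, x3, x4. cbn. ring.
Qed.

Lemma Dcurve_ext_loc (a b : R -> R41) v :
  locally v (fun r => a r = b r) -> Dcurve a v = Dcurve b v.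
Proof.
  intros H.
  apply R41_ext; apply Derive_ext_loc; apply filter_imp with (2 := H);
    intros r ->; reflexivity.
Qed.

Lemma Dcurve_combination (p q : R -> R) (a c : R41) s :
  ex_derive p s -> ex_derive q s ->
  Dcurve (fun r => plus (scal (p r) a) (scal (q r) c)) s
  = plus (scal (Derive p s) a) (scal (Derive q s) c).
Proof.
  intros Hp Hq.
  assert (E : forall y z : R, Derive (fun r => p r * y + q r * z) s
                = Derive p s * y + Derive q s * z).
  { intros y z. rewrite Derive_plus, !Derive_scal_l; [reflexivity| |];
      apply ex_derive_mult; (assumption || apply ex_derive_const). }
  apply R41_ext; apply E.
Qed.

Lemma Dcurve_scal_function (p : R -> R) (a : R41) s :
  Dcurve (fun r => scal (p r) a) s = scal (Derive p s) a.
Proof. apply R41_ext; apply Derive_scal_l. Qed.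

Lemma Dcurve_affine (k : R) (w : R -> R41) (c : R41) v :
  differentiable_curve w v ->
  Dcurve (fun r => plus (scal k (w r)) c) v = scal k (Dcurve w v).
Proof.
  intros (W1 & W2 & W3 & W4).
  assert (E : forall (h : R -> R) (y : R), ex_derive h v ->
            Derive (fun r => k * h r + y) v = k * Derive h v).
  { intros h y Hh. rewrite Derive_plus, Derive_scal, Derive_const; [ring| |].
    - apply ex_derive_scal. assumption.
    - apply ex_derive_const. }
  apply R41_ext.
  - exact (E (fun r => x1 (w r)) (x1 c) W1).
  - exact (E (fun r => x2 (w r)) (x2 c) W2).
  - exact (E (fun r => x3 (w r)) (x3 c) W3).
  - exact (E (fun r => x4 (w r)) (x4 c) W4).
Qed.

Lemma Dcurve_scal (k : R) (w : R -> R41) v :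
  Dcurve (fun r => scal k (w r)) v = scal k (Dcurve w v).
Proof. apply R41_ext; apply Derive_scal. Qed.

(** * Surfaces in orthogonal coordinates *)

Definition orthogonal_coordinates (z : R -> R -> R41) (u v : R) : Prop :=
  mink (pd 0 z u v) (pd 0 z u v) <> 0 /\ mink (pd 1 z u v) (pd 1 z u v) <> 0 /\
  mink (pd 0 z u v) (pd 1 z u v) = 0.

Definition normal_vector (z : R -> R -> R41) (u v : R) (nu : R41) : Prop :=
  mink nu (pd 0 z u v) = 0 /\ mink nu (pd 1 z u v) = 0.

Lemma sum_n_R41_01 (h : nat -> R41) : sum_n h 1 = plus (h 0%nat) (h 1%nat).
Proof. rewrite sum_Sn, sum_O. reflexivity. Qed.

Lemma metric_inv_orthogonal z u v :
  orthogonal_coordinates z u v ->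
  metric_inv z u v 0 0 = / mink (pd 0 z u v) (pd 0 z u v) /\
  metric_inv z u v 0 1 = 0 /\ metric_inv z u v 1 0 = 0 /\
  metric_inv z u v 1 1 = / mink (pd 1 z u v) (pd 1 z u v).
Proof.
  intros (HE & HG & HF).
  unfold metric_inv, inv2, det2, metric.
  rewrite !coeff_mat_bij by auto with arith.
  rewrite (mink_sym (pd 1 z u v) (pd 0 z u v)), HF.
  repeat split; field; auto.
Qed.

Lemma mink_tangential_part z u v w nu :
  orthogonal_coordinates z u v ->
  mink (tangential_part z u v w) nu
  = mink w (pd 0 z u v) * mink (pd 0 z u v) nu / mink (pd 0 z u v) (pd 0 z u v)
    + mink w (pd 1 z u v) * mink (pd 1 z u v) nu / mink (pd 1 z u v) (pd 1 z u v).
Proof.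
  intros Ho. destruct (metric_inv_orthogonal z u v Ho) as (M00 & M01 & M10 & M11).
  destruct Ho as (HE & HG & _).
  unfold tangential_part. rewrite !sum_n_R41_01.
  rewrite !mink_plus_l, !mink_scal_l, M00, M01, M10, M11. field. auto.
Qed.

Lemma normal_part_normal z u v w :
  orthogonal_coordinates z u v -> normal_vector z u v (normal_part z u v w).
Proof.
  intros Ho. unfold normal_part.
  split; rewrite mink_minus_l, mink_tangential_part by assumption;
    destruct Ho as (HE & HG & HF);
    rewrite ?(mink_sym (pd 1 z u v) (pd 0 z u v)), ?HF; field; auto.
Qed.

Lemma mink_second_form z i j u v nu :
  orthogonal_coordinates z u v -> normal_vector z u v nu ->
  mink (second_form z i j u v) nu = mink (pd i (pd j z) u v) nu.
Proof.
  intros Ho [N0 N1]. unfold second_form, normal_part.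
  rewrite mink_minus_l, mink_tangential_part by assumption.
  rewrite (mink_sym (pd 0 z u v) nu), (mink_sym (pd 1 z u v) nu), N0, N1.
  destruct Ho as (HE & HG & HF). field. auto.
Qed.

Lemma mink_mean_curvature z u v nu :
  orthogonal_coordinates z u v ->
  mink (mean_curvature z u v) nu
  = (mink (second_form z 0 0 u v) nu / mink (pd 0 z u v) (pd 0 z u v)
     + mink (second_form z 1 1 u v) nu / mink (pd 1 z u v) (pd 1 z u v)) / 2.
Proof.
  intros Ho. destruct (metric_inv_orthogonal z u v Ho) as (M00 & M01 & M10 & M11).
  unfold mean_curvature. rewrite !sum_n_R41_01.
  rewrite mink_scal_l, !mink_plus_l, !mink_scal_l, M00, M01, M10, M11.
  destruct Ho as (HE & HG & _). field. auto.
Qed.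

Lemma mean_curvature_normal z u v :
  orthogonal_coordinates z u v -> normal_vector z u v (mean_curvature z u v).
Proof.
  intros Ho.
  pose proof (fun i j => normal_part_normal z u v (pd i (pd j z) u v) Ho) as N.
  destruct (N 0 0)%nat as [A0 A1], (N 1 1)%nat as [B0 B1].
  fold (second_form z 0 0 u v) in A0, A1. fold (second_form z 1 1 u v) in B0, B1.
  destruct Ho as (HE & HG & HF).
  split; rewrite mink_mean_curvature by (repeat split; assumption).
  - rewrite A0, B0. field. auto.
  - rewrite A1, B1. field. auto.
Qed.

Lemma tr2_product_of_raised_forms (m a b : nat -> nat -> R) :
  m 0%nat 1%nat = 0 -> m 1%nat 0%nat = 0 -> m 0%nat 0%nat <> 0 -> m 1%nat 1%nat <> 0 ->
  a 0%nat 1%nat = 0 -> a 1%nat 0%nat = 0 ->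
  tr2 (Mmult (Mmult (inv2 (mk_matrix 2 2 m)) (mk_matrix 2 2 a))
             (Mmult (inv2 (mk_matrix 2 2 m)) (mk_matrix 2 2 b)))
  = a 0%nat 0%nat * b 0%nat 0%nat / m 0%nat 0%nat ^ 2
    + a 1%nat 1%nat * b 1%nat 1%nat / m 1%nat 1%nat ^ 2.
Proof.
  intros M01 M10 M00 M11 A01 A10.
  unfold tr2, Mmult, inv2, det2.
  do 3 (rewrite !coeff_mat_bij by auto with arith;
        cbn [Nat.pred]; rewrite ?sum_Sn, ?sum_O).
  rewrite M01, M10, A01, A10.
  unfold plus, mult; cbn. field. auto.
Qed.

Lemma tr2_shape_operators z nu nu' u v :
  orthogonal_coordinates z u v -> normal_vector z u v nu -> normal_vector z u v nu' ->
  mink (pd 0 (pd 1 z) u v) nu = 0 -> mink (pd 1 (pd 0 z) u v) nu = 0 ->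
  tr2 (Mmult (shape_operator z nu u v) (shape_operator z nu' u v))
  = mink (pd 0 (pd 0 z) u v) nu * mink (pd 0 (pd 0 z) u v) nu'
      / mink (pd 0 z u v) (pd 0 z u v) ^ 2
    + mink (pd 1 (pd 1 z) u v) nu * mink (pd 1 (pd 1 z) u v) nu'
      / mink (pd 1 z u v) (pd 1 z u v) ^ 2.
Proof.
  intros Ho N N' S01 S10. unfold shape_operator, metric.
  rewrite tr2_product_of_raised_forms.
  - rewrite !mink_second_form by assumption. reflexivity.
  - apply Ho.
  - rewrite mink_sym. apply Ho.
  - apply Ho.
  - apply Ho.
  - rewrite mink_second_form by assumption. exact S01.
  - rewrite mink_second_form by assumption. exact S10.
Qed.

(** * Meridian curves *)

(** [s = 1] is the elliptic and [s = -1] the hyperbolic case. *)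
Record meridian_curve (s : R) (I : R -> Prop) (f g : R -> R) : Prop := {
  mer_s : s * s = 1;
  mer_I : interval I;
  mer_f_smooth : smooth_on I f;
  mer_g_smooth : smooth_on I g;
  mer_f_pos : forall u, I u -> 0 < f u;
  mer_arclength : forall u, I u -> Derive f u ^ 2 - s * Derive g u ^ 2 = 1;
  mer_g_sign : forall u, I u -> 0 <= Derive g u
}.

Lemma smooth_is_derive I f u : smooth_on I f -> I u -> is_derive f u (Derive f u).
Proof. intros Hf Iu. apply Derive_correct, (smooth_on_ex_derive_n I f u 1 Hf Iu). Qed.

Lemma smooth_is_derive_Derive I f u :
  smooth_on I f -> I u -> is_derive (Derive f) u (Derive_n f 2 u).
Proof. intros Hf Iu. apply Derive_correct, (smooth_on_ex_derive_n I f u 2 Hf Iu). Qed.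

Lemma smooth_is_derive_Derive_n_2 I f u :
  smooth_on I f -> I u -> is_derive (Derive_n f 2) u (Derive_n f 3 u).
Proof. intros Hf Iu. apply Derive_correct, (smooth_on_ex_derive_n I f u 3 Hf Iu). Qed.

(** The arc length condition, differentiated, and the definition of the curvature
    are two linear equations for the second derivatives with determinant
    [f' ^ 2 - s g' ^ 2 = 1]. *)
Lemma meridian_frenet s I f g u :
  meridian_curve s I f g -> I u ->
  Derive_n f 2 u = s * meridian_curvature f g u * Derive g u /\
  Derive_n g 2 u = meridian_curvature f g u * Derive f u.
Proof.
  intros M Iu.
  pose proof (mer_s _ _ _ _ M) as Hs.
  pose proof (smooth_is_derive_Derive I f u (mer_f_smooth _ _ _ _ M) Iu) as Df.
  pose proof (smooth_is_derive_Derive I g u (mer_g_smooth _ _ _ _ M) Iu) as Dg.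
  assert (D : is_derive (fun r => Derive f r ^ 2 - s * Derive g r ^ 2) u
                (2 * Derive f u * Derive_n f 2 u - s * (2 * Derive g u * Derive_n g 2 u))).
  { generalize dependent (Derive_n f 2 u). generalize dependent (Derive_n g 2 u).
    intros g2 Dg f2 Df. auto_derive.
    - split; [exists f2 | split; [exists g2|]]; auto.
    - rewrite (is_derive_unique _ _ _ Df : Derive (fun r => Derive f r) u = f2).
      rewrite (is_derive_unique _ _ _ Dg : Derive (fun r => Derive g r) u = g2). ring. }
  pose proof (is_derive_of_constant_on I _ 1 u _ (mer_I _ _ _ _ M)
                (mer_arclength _ _ _ _ M) Iu D) as E.
  pose proof (mer_arclength _ _ _ _ M u Iu) as A.
  unfold meridian_curvature.
  generalize dependent (Derive_n f 2 u). generalize dependent (Derive_n g 2 u).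
  generalize dependent (Derive f u). generalize dependent (Derive g u).
  intros g1 f1 A g2 _ f2 _ _ E.
  assert (E' : f1 * f2 = s * g1 * g2) by lra.
  split.
  - transitivity (f2 * (f1 ^ 2 - s * g1 ^ 2)); [rewrite A; ring|].
    transitivity (f1 * (f1 * f2) - s * g1 ^ 2 * f2); [ring|]. rewrite E'. ring.
  - transitivity (g2 * (f1 ^ 2 - s * g1 ^ 2)); [rewrite A; ring|].
    transitivity (f1 ^ 2 * g2 - g1 * (s * g1 * g2)); [ring|]. rewrite <- E'. ring.
Qed.

(** * Meridian surfaces *)

Definition meridian_surface (e : R41) (f g : R -> R) (l : R -> R41) (u v : R) : R41 :=
  plus (scal (f u) (l v)) (scal (g u) e).

Record meridian_data (s : R) (e : R41) (I J : R -> Prop) (f g : R -> R)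
    (l n : R -> R41) : Prop := {
  mer_curve : meridian_curve s I f g;
  mer_J : interval J;
  mer_l_smooth : smooth_curve_on J l;
  mer_n_smooth : smooth_curve_on J n;
  mer_ee : mink e e = - s;
  mer_le : forall v, J v -> mink (l v) e = 0;
  mer_ne : forall v, J v -> mink (n v) e = 0;
  mer_ll : forall v, J v -> mink (l v) (l v) = 1;
  mer_tt : forall v, J v -> mink (Dcurve l v) (Dcurve l v) = 1;
  mer_nn : forall v, J v -> mink (n v) (n v) = s;
  mer_ln : forall v, J v -> mink (l v) (n v) = 0;
  mer_tn : forall v, J v -> mink (Dcurve l v) (n v) = 0
}.

Lemma elliptic_meridian_data I J f g l n :
  elliptic_data I J f g l n -> meridian_data 1 e4 I J f g l n.
Proof.
  intros []. constructor; auto.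
  - constructor; auto; [ring| |].
    + intros u Iu. rewrite Rmult_1_l. auto.
    + intros u Iu. rewrite ell_g_sign by assumption. apply sqrt_pos.
  - unfold mink, e4, x1, x2, x3, x4; cbn. ring.
  - intros v Jv. specialize (ell_l_span v Jv).
    unfold mink. rewrite ell_l_span. unfold e4, x1, x2, x3, x4; cbn. ring.
  - intros v Jv. specialize (ell_n_span v Jv).
    unfold mink. rewrite ell_n_span. unfold e4, x1, x2, x3, x4; cbn. ring.
Qed.

Lemma hyperbolic_meridian_data I J f g l n :
  hyperbolic_data I J f g l n -> meridian_data (-1) e1 I J f g l n.
Proof.
  intros []. constructor; auto.
  - constructor; auto; [ring| |].
    + intros u Iu. rewrite <- (hyp_arclength u Iu). ring.
    + intros u Iu. rewrite hyp_g_sign by assumption. apply sqrt_pos.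
  - unfold mink, e1, x1, x2, x3, x4; cbn. ring.
  - intros v Jv. specialize (hyp_l_span v Jv).
    unfold mink. rewrite hyp_l_span. unfold e1, x1, x2, x3, x4; cbn. ring.
  - intros v Jv. specialize (hyp_n_span v Jv).
    unfold mink. rewrite hyp_n_span. unfold e1, x1, x2, x3, x4; cbn. ring.
Qed.

Lemma derivative_of_constant_product J (a b : R -> R41) c v :
  interval J -> (forall r, J r -> mink (a r) (b r) = c) -> J v ->
  differentiable_curve a v -> differentiable_curve b v ->
  mink (Dcurve a v) (b v) + mink (a v) (Dcurve b v) = 0.
Proof.
  intros HJ Hc Jv Ha Hb.
  exact (is_derive_of_constant_on J _ c v _ HJ Hc Jv (is_derive_mink a b v Ha Hb)).
Qed.

Lemma mink_tl s e I J f g l n v :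
  meridian_data s e I J f g l n -> J v -> mink (Dcurve l v) (l v) = 0.
Proof.
  intros D Jv.
  destruct (smooth_curve_differentiable J l v (mer_l_smooth _ _ _ _ _ _ _ _ D) Jv)
    as (Dl & _ & _).
  pose proof (derivative_of_constant_product J l l 1 v (mer_J _ _ _ _ _ _ _ _ D)
    (mer_ll _ _ _ _ _ _ _ _ D) Jv Dl Dl) as E.
  rewrite (mink_sym (l v)) in E. lra.
Qed.

Lemma mink_te s e I J f g l n v :
  meridian_data s e I J f g l n -> J v -> mink (Dcurve l v) e = 0.
Proof.
  intros D Jv.
  destruct (smooth_curve_differentiable J l v (mer_l_smooth _ _ _ _ _ _ _ _ D) Jv)
    as (Dl & _ & _).
  pose proof (derivative_of_constant_product J l (fun _ => e) 0 v
    (mer_J _ _ _ _ _ _ _ _ D) (mer_le _ _ _ _ _ _ _ _ D) Jv Dl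
    (differentiable_curve_const e v)) as E.
  rewrite Dcurve_const, mink_zero_r in E. lra.
Qed.

Lemma meridian_frame s e I J f g l n v :
  meridian_data s e I J f g l n -> J v ->
  orthonormal_frame s (l v) (Dcurve l v) (n v) e.
Proof.
  intros D Jv. pose proof (mink_tl _ _ _ _ _ _ _ _ _ D Jv).
  pose proof (mink_te _ _ _ _ _ _ _ _ _ D Jv).
  destruct D as [M]. destruct M. constructor; auto.
  rewrite mink_sym. assumption.
Qed.

Lemma acceleration_products s e I J f g l n v :
  meridian_data s e I J f g l n -> J v ->
  mink (l v) (Dcurve (Dcurve l) v) = -1 /\
  mink (Dcurve l v) (Dcurve (Dcurve l) v) = 0 /\
  mink e (Dcurve (Dcurve l) v) = 0.
Proof.
  intros D Jv.
  destruct (smooth_curve_differentiable J l v (mer_l_smooth _ _ _ _ _ _ _ _ D) Jv)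
    as (Dl & Dt & _).
  pose proof (mer_J _ _ _ _ _ _ _ _ D) as HJ.
  pose proof (derivative_of_constant_product J (Dcurve l) l 0 v HJ
    (fun r => mink_tl _ _ _ _ _ _ _ _ r D) Jv Dt Dl) as E1.
  pose proof (derivative_of_constant_product J (Dcurve l) (Dcurve l) 1 v HJ
    (mer_tt _ _ _ _ _ _ _ _ D) Jv Dt Dt) as E2.
  pose proof (derivative_of_constant_product J (Dcurve l) (fun _ => e) 0 v HJ
    (fun r => mink_te _ _ _ _ _ _ _ _ r D) Jv Dt (differentiable_curve_const e v)) as E3.
  rewrite (mer_tt _ _ _ _ _ _ _ _ D v Jv) in E1.
  rewrite (mink_sym (Dcurve (Dcurve l) v) (Dcurve l v)) in E2.
  rewrite Dcurve_const, mink_zero_r in E3.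
  rewrite (mink_sym (l v)), (mink_sym e). repeat split; lra.
Qed.

Section MeridianSurface.

Variables (s : R) (e : R41) (I J : R -> Prop) (f g : R -> R) (l n : R -> R41).
Hypothesis data : meridian_data s e I J f g l n.

Let z := meridian_surface e f g l.

Lemma meridian_pd_u u v : I u ->
  pd 0 z u v = plus (scal (Derive f u) (l v)) (scal (Derive g u) e).
Proof.
  intros Iu. pose proof (mer_curve _ _ _ _ _ _ _ _ data) as M.
  apply (Dcurve_combination f g).
  - exact (smooth_on_ex_derive_n I f u 1 (mer_f_smooth _ _ _ _ M) Iu).
  - exact (smooth_on_ex_derive_n I g u 1 (mer_g_smooth _ _ _ _ M) Iu).
Qed.

Lemma meridian_pd_v u v : J v -> pd 1 z u v = scal (f u) (Dcurve l v).
Proof.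
  intros Jv. apply (Dcurve_affine (f u) l).
  apply (smooth_curve_differentiable J l v (mer_l_smooth _ _ _ _ _ _ _ _ data) Jv).
Qed.

Lemma meridian_pd_uu u v : I u ->
  pd 0 (pd 0 z) u v = plus (scal (Derive_n f 2 u) (l v)) (scal (Derive_n g 2 u) e).
Proof.
  intros Iu. pose proof (mer_curve _ _ _ _ _ _ _ _ data) as M.
  pose proof (mer_f_smooth _ _ _ _ M) as Sf. pose proof (mer_g_smooth _ _ _ _ M) as Sg.
  transitivity
    (Dcurve (fun r => plus (scal (Derive f r) (l v)) (scal (Derive g r) e)) u).
  - apply Dcurve_ext_loc.
    pose proof (filter_and _ _ (smooth_on_locally_ex_derive _ _ _ Sf Iu)
                  (smooth_on_locally_ex_derive _ _ _ Sg Iu)) as L.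
    apply filter_imp with (2 := L). intros r [Hf Hg].
    apply (Dcurve_combination f g); assumption.
  - apply (Dcurve_combination (Derive f) (Derive g)).
    + exact (smooth_on_ex_derive_n I f u 2 Sf Iu).
    + exact (smooth_on_ex_derive_n I g u 2 Sg Iu).
Qed.

Lemma meridian_pd_uv u v : J v ->
  pd 0 (pd 1 z) u v = scal (Derive f u) (Dcurve l v).
Proof.
  intros Jv. transitivity (Dcurve (fun r => scal (f r) (Dcurve l v)) u).
  - apply Dcurve_ext_loc, filter_forall. intros r. apply meridian_pd_v, Jv.
  - apply Dcurve_scal_function.
Qed.

Lemma meridian_pd_vu u v : I u -> J v ->
  pd 1 (pd 0 z) u v = scal (Derive f u) (Dcurve l v).
Proof.
  intros Iu Jv.
  transitivity (Dcurve (fun r => plus (scal (Derive f u) (l r)) (scal (Derive g u) e)) v).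
  - apply Dcurve_ext_loc, filter_forall. intros r. apply meridian_pd_u, Iu.
  - apply (Dcurve_affine (Derive f u) l).
    apply (smooth_curve_differentiable J l v (mer_l_smooth _ _ _ _ _ _ _ _ data) Jv).
Qed.

Lemma meridian_pd_vv u v : J v ->
  pd 1 (pd 1 z) u v = scal (f u) (Dcurve (Dcurve l) v).
Proof.
  intros Jv. transitivity (Dcurve (fun r => scal (f u) (Dcurve l r)) v).
  - apply Dcurve_ext_loc.
    apply filter_imp with (2 := smooth_curve_locally_differentiable J l v
      (mer_l_smooth _ _ _ _ _ _ _ _ data) Jv).
    intros r Hr. exact (Dcurve_affine (f u) l _ r Hr).
  - apply Dcurve_scal.
Qed.

Lemma meridian_metric u v : I u -> J v ->
  mink (pd 0 z u v) (pd 0 z u v) = 1 /\ mink (pd 0 z u v) (pd 1 z u v) = 0 /\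
  mink (pd 1 z u v) (pd 1 z u v) = f u ^ 2.
Proof.
  intros Iu Jv. pose proof (meridian_frame _ _ _ _ _ _ _ _ _ data Jv) as F.
  pose proof (mer_arclength _ _ _ _ (mer_curve _ _ _ _ _ _ _ _ data) u Iu) as A.
  rewrite meridian_pd_u, meridian_pd_v by assumption.
  rewrite !mink_plus_l, !mink_plus_r, !mink_scal_l, !mink_scal_r.
  rewrite (mink_sym e (l v)), (mink_sym e (Dcurve l v)).
  rewrite (frame_ll _ _ _ _ _ F), (frame_le _ _ _ _ _ F), (frame_lt _ _ _ _ _ F),
    (frame_te _ _ _ _ _ F), (frame_tt _ _ _ _ _ F), (frame_ee _ _ _ _ _ F).
  split; [|split; ring].
  transitivity (Derive f u ^ 2 - s * Derive g u ^ 2); [ring | exact A].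
Qed.

Lemma meridian_orthogonal u v : I u -> J v -> orthogonal_coordinates z u v.
Proof.
  intros Iu Jv. destruct (meridian_metric u v Iu Jv) as (E & F & G).
  pose proof (mer_f_pos _ _ _ _ (mer_curve _ _ _ _ _ _ _ _ data) u Iu) as Hf.
  unfold orthogonal_coordinates. rewrite E, F, G. repeat split; [lra|].
  apply pow_nonzero. lra.
Qed.

(** The unit normal of the meridian curve, carried to the point [(u, v)];
    together with [n] it spans the normal plane. *)
Definition meridian_normal (u v : R) : R41 :=
  plus (scal (s * Derive g u) (l v)) (scal (Derive f u) e).

Lemma normal_vector_components u v nu : I u -> J v -> normal_vector z u v nu ->
  mink (l v) nu = - Derive g u * mink (meridian_normal u v) nu /\
  mink (Dcurve l v) nu = 0 /\
  mink e nu = Derive f u * mink (meridian_normal u v) nu.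
Proof.
  intros Iu Jv [N0 N1]. pose proof (mer_curve _ _ _ _ _ _ _ _ data) as M.
  pose proof (mer_arclength _ _ _ _ M u Iu) as A. pose proof (mer_s _ _ _ _ M) as Hs.
  rewrite mink_sym, meridian_pd_u in N0 by assumption.
  rewrite mink_sym, meridian_pd_v in N1 by assumption.
  unfold meridian_normal.
  rewrite mink_scal_l in N1. rewrite mink_plus_l, !mink_scal_l in N0 |- *.
  generalize dependent (mink (l v) nu). generalize dependent (mink e nu).
  intros y x N0. repeat split.
  - transitivity (x * (Derive f u ^ 2 - s * Derive g u ^ 2)); [rewrite A; ring|].
    transitivity (Derive f u * (Derive f u * x + Derive g u * y)
                  - Derive g u * (s * Derive g u * x + Derive f u * y)); [ring|].
    rewrite N0. ring.
  - pose proof (mer_f_pos _ _ _ _ M u Iu).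
    apply Rmult_integral in N1. destruct N1; [lra|assumption].
  - transitivity (y * (Derive f u ^ 2 - s * Derive g u ^ 2)); [rewrite A; ring|].
    transitivity (Derive f u * (s * Derive g u * x + Derive f u * y)
                  - s * Derive g u * (Derive f u * x + Derive g u * y)); [ring|].
    rewrite N0. ring.
Qed.

Lemma mink_normal_vectors u v nu nu' : I u -> J v ->
  normal_vector z u v nu -> normal_vector z u v nu' ->
  mink nu nu' = s * (mink (n v) nu * mink (n v) nu'
                     - mink (meridian_normal u v) nu * mink (meridian_normal u v) nu').
Proof.
  intros Iu Jv N N'.
  destruct (normal_vector_components u v nu Iu Jv N) as (L & T & E).
  destruct (normal_vector_components u v nu' Iu Jv N') as (L' & T' & E').
  pose proof (mer_curve _ _ _ _ _ _ _ _ data) as M.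
  pose proof (mer_arclength _ _ _ _ M u Iu) as A. pose proof (mer_s _ _ _ _ M) as Hs.
  rewrite (parseval s _ _ _ e nu nu' (meridian_frame _ _ _ _ _ _ _ _ _ data Jv)).
  rewrite L, T, E, L', T', E'.
  generalize (mink (meridian_normal u v) nu), (mink (meridian_normal u v) nu').
  intros q q'.
  transitivity (s * (mink (n v) nu * mink (n v) nu')
                - q * q' * (s * Derive f u ^ 2 - Derive g u ^ 2)); [ring|].
  replace (s * Derive f u ^ 2 - Derive g u ^ 2) with s; [ring|].
  transitivity (s * (Derive f u ^ 2 - s * Derive g u ^ 2)); [rewrite A; ring|].
  transitivity (s * Derive f u ^ 2 - (s * s) * Derive g u ^ 2); [ring|].
  rewrite Hs. ring.
Qed.

(** [z_u] changes by [kappa_m] times the meridian normal, by the Frenet equations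
    of the meridian; [z_v = f t] changes with [t' = - l + s kappa n].  The mixed
    derivative is tangent, so the coordinate lines are lines of curvature for
    every normal vector. *)
Lemma meridian_second_derivatives u v nu : I u -> J v -> normal_vector z u v nu ->
  mink (pd 0 (pd 0 z) u v) nu
    = meridian_curvature f g u * mink (meridian_normal u v) nu /\
  mink (pd 0 (pd 1 z) u v) nu = 0 /\ mink (pd 1 (pd 0 z) u v) nu = 0 /\
  mink (pd 1 (pd 1 z) u v) nu
    = f u * (Derive g u * mink (meridian_normal u v) nu
             + s * spherical_curvature l n v * mink (n v) nu).
Proof.
  intros Iu Jv N.
  destruct (normal_vector_components u v nu Iu Jv N) as (L & T & E).
  destruct (acceleration_products _ _ _ _ _ _ _ _ _ data Jv) as (AL & AT & AE).
  rewrite meridian_pd_uu, meridian_pd_uv, meridian_pd_vu, meridian_pd_vv by assumption.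
  rewrite mink_plus_l, !mink_scal_l.
  rewrite (parseval s _ _ _ e (Dcurve (Dcurve l) v) nu
             (meridian_frame _ _ _ _ _ _ _ _ _ data Jv)).
  rewrite AL, AT, AE, L, T, E.
  unfold meridian_curvature, spherical_curvature.
  rewrite (mink_sym (n v) (Dcurve _ v)).
  repeat split; ring.
Qed.

(** In the normal plane, [2 f H] has the coordinates [s kappa] along [n] and [P u]
    along the meridian normal. *)
Let P u := f u * meridian_curvature f g u + Derive g u.

Lemma meridian_mean_curvature u v nu : I u -> J v -> normal_vector z u v nu ->
  mink (mean_curvature z u v) nu
  = (P u * mink (meridian_normal u v) nu
     + s * spherical_curvature l n v * mink (n v) nu) / (2 * f u).
Proof.
  intros Iu Jv N. pose proof (meridian_orthogonal u v Iu Jv) as Ho.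
  destruct (meridian_metric u v Iu Jv) as (ME & _ & MG).
  destruct (meridian_second_derivatives u v nu Iu Jv N) as (S00 & _ & _ & S11).
  pose proof (mer_f_pos _ _ _ _ (mer_curve _ _ _ _ _ _ _ _ data) u Iu) as Hf.
  rewrite mink_mean_curvature, !mink_second_form by assumption.
  rewrite ME, MG, S00, S11. unfold P. field. lra.
Qed.

Lemma spherical_normal_normal u v : I u -> J v -> normal_vector z u v (n v).
Proof.
  intros Iu Jv. pose proof (meridian_frame _ _ _ _ _ _ _ _ _ data Jv) as F.
  split; rewrite mink_sym.
  - rewrite meridian_pd_u, mink_plus_l, !mink_scal_l, (mink_sym e) by assumption.
    rewrite (frame_ln _ _ _ _ _ F), (frame_ne _ _ _ _ _ F). ring.
  - rewrite meridian_pd_v, mink_scal_l, (frame_tn _ _ _ _ _ F) by assumption. ring.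
Qed.

Lemma meridian_normal_normal u v : I u -> J v -> normal_vector z u v (meridian_normal u v).
Proof.
  intros Iu Jv. pose proof (meridian_frame _ _ _ _ _ _ _ _ _ data Jv) as F.
  unfold meridian_normal. split; rewrite mink_plus_l, !mink_scal_l.
  - rewrite meridian_pd_u, !mink_plus_r, !mink_scal_r, (mink_sym e (l v)) by assumption.
    rewrite (frame_ll _ _ _ _ _ F), (frame_le _ _ _ _ _ F), (frame_ee _ _ _ _ _ F). ring.
  - rewrite meridian_pd_v, !mink_scal_r, (mink_sym e (Dcurve l v)) by assumption.
    rewrite (frame_lt _ _ _ _ _ F), (frame_te _ _ _ _ _ F). ring.
Qed.

Lemma meridian_normal_products u v : I u -> J v ->
  mink (meridian_normal u v) (meridian_normal u v) = - s /\
  mink (n v) (meridian_normal u v) = 0 /\ mink (n v) (n v) = s.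
Proof.
  intros Iu Jv. pose proof (meridian_frame _ _ _ _ _ _ _ _ _ data Jv) as F.
  pose proof (mer_curve _ _ _ _ _ _ _ _ data) as M.
  pose proof (mer_arclength _ _ _ _ M u Iu) as A. pose proof (mer_s _ _ _ _ M) as Hs.
  unfold meridian_normal.
  rewrite !mink_plus_l, !mink_plus_r, !mink_scal_l, !mink_scal_r.
  rewrite (mink_sym e (l v)), (mink_sym (n v) (l v)).
  rewrite (frame_ll _ _ _ _ _ F), (frame_le _ _ _ _ _ F), (frame_ee _ _ _ _ _ F),
    (frame_ln _ _ _ _ _ F), (frame_ne _ _ _ _ _ F), (frame_nn _ _ _ _ _ F).
  repeat split; [|ring].
  transitivity (- s * (Derive f u ^ 2 - s * Derive g u ^ 2)); [|rewrite A]; ring.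
Qed.

(** Describe a normal vector by the pair of its products with [n] and with the
    meridian normal.  As [c] is orthogonal to [H], its pair is a multiple of
    [(P, - s kappa)]; as [b] is orthogonal to [c], its pair is a multiple of
    [(s kappa, - P)].  With these pairs the trace factors, and only the factor
    [(f kappa_m)^2 + kappa^2 - g'^2] can vanish. *)
Lemma allied_mean_curvature_eq_zero_iff b c u v : I u -> J v ->
  meridian_curvature f g u * spherical_curvature l n v <> 0 ->
  mink (mean_curvature z u v) (mean_curvature z u v) <> 0 ->
  adapted_normal_frame z b c u v ->
  allied_mean_curvature z b c u v = zero <->
  Derive g u ^ 2
  = (f u * meridian_curvature f g u) ^ 2 + spherical_curvature l n v ^ 2.
Proof.
  intros Iu Jv Hgen HH (B0 & B1 & C0 & C1 & BC & BB & CC & k & Hk).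
  pose proof (mer_curve _ _ _ _ _ _ _ _ data) as M.
  pose proof (mer_f_pos _ _ _ _ M u Iu) as Hf. pose proof (mer_s _ _ _ _ M) as Hs.
  pose proof (conj B0 B1 : normal_vector z u v b) as NB.
  pose proof (conj C0 C1 : normal_vector z u v c) as NC.
  destruct (meridian_metric u v Iu Jv) as (ME & _ & MG).
  destruct (meridian_second_derivatives u v b Iu Jv NB) as (SB0 & SB01 & SB10 & SB1).
  destruct (meridian_second_derivatives u v c Iu Jv NC) as (SC0 & _ & _ & SC1).
  pose proof (tr2_shape_operators z b c u v (meridian_orthogonal u v Iu Jv) NB NC SB01 SB10)
    as Htr.
  rewrite ME, MG, SB0, SB1, SC0, SC1 in Htr.
  (* As [H] is a multiple of [b], it is orthogonal to [c]. *)
  pose proof (meridian_mean_curvature u v c Iu Jv NC) as HC.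
  rewrite Hk, mink_scal_l, BC, Rmult_0_r in HC.
  pose proof (mink_normal_vectors u v b c Iu Jv NB NC) as PBC. rewrite BC in PBC.
  pose proof (mink_normal_vectors u v b b Iu Jv NB NB) as PBB.
  pose proof (mink_normal_vectors u v c c Iu Jv NC NC) as PCC.
  assert (BB0 : mink b b <> 0) by (intros E; rewrite E, Rabs_R0 in BB; lra).
  assert (CC0 : mink c c <> 0) by (intros E; rewrite E, Rabs_R0 in CC; lra).
  assert (Hnorm : pseudo_norm (mean_curvature z u v) <> 0).
  { unfold pseudo_norm. apply Rgt_not_eq, sqrt_lt_R0, Rabs_pos_lt, HH. }
  assert (Hm0 : meridian_curvature f g u <> 0) by (intros E; apply Hgen; rewrite E; ring).
  assert (Hk0 : spherical_curvature l n v <> 0) by (intros E; apply Hgen; rewrite E; ring).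
  rewrite PBB in BB0. rewrite PCC in CC0.
  assert (Hzero : allied_mean_curvature z b c u v = zero <->
            tr2 (Mmult (shape_operator z b u v) (shape_operator z c u v)) = 0).
  { unfold allied_mean_curvature. split; intros H.
    - apply scal_R41_eq_zero in H; [|rewrite PCC; exact CC0].
      apply Rmult_integral in H. destruct H as [H|H]; [exfalso; lra|exact H].
    - rewrite H, Rmult_0_r. exact (scal_zero_l c). }
  rewrite Hzero, Htr. clear Htr Hzero SB0 SB1 SC0 SC1.
  unfold P in HC.
  set (km := meridian_curvature f g u) in *. set (ka := spherical_curvature l n v) in *.
  generalize dependent (mink (n v) b). generalize dependent (mink (meridian_normal u v) b).
  generalize dependent (mink (n v) c). generalize dependent (mink (meridian_normal u v) c).
  intros qc pc HC PCC CC0 qb pb PBC PBB BB0.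
  assert (HC' : (f u * km + Derive g u) * qc + s * ka * pc = 0).
  { apply Rmult_eq_reg_r with (/ (2 * f u)).
    - unfold Rdiv in HC. rewrite <- HC. ring.
    - apply Rinv_neq_0_compat. lra. }
  assert (Hs0 : s <> 0) by (intros E; rewrite E in Hs; lra).
  assert (Hbc : pb * pc = qb * qc).
  { assert (E : s * (pb * pc - qb * qc) = 0) by lra.
    apply Rmult_integral in E. destruct E; [tauto|lra]. }
  set (m := - (s * qc / ka)).
  assert (Hqc : qc = - (s * ka * m)).
  { unfold m. transitivity ((s * s) * qc); [rewrite Hs; ring|]. field. exact Hk0. }
  assert (Hpc : pc = m * (f u * km + Derive g u)).
  { apply Rmult_eq_reg_l with (s * ka); [|apply Rmult_integral_contrapositive; tauto].
    transitivity (- ((f u * km + Derive g u) * qc)); [lra|]. rewrite Hqc. ring. }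
  assert (Hm : m <> 0).
  { intros E. apply CC0. rewrite Hpc, Hqc, E. ring. }
  set (r := s * pb / ka).
  assert (Hpb : pb = s * ka * r).
  { unfold r. transitivity ((s * s) * pb); [rewrite Hs; ring|]. field. exact Hk0. }
  assert (Hqb : qb = - (r * (f u * km + Derive g u))).
  { apply Rmult_eq_reg_l with (s * ka * m).
    - transitivity (- (qb * qc)); [rewrite Hqc; ring|].
      rewrite <- Hbc, Hpb, Hpc. ring.
    - repeat apply Rmult_integral_contrapositive_currified; assumption. }
  assert (Hr : r <> 0).
  { intros E. apply BB0. rewrite Hpb, Hqb, E. ring. }
  clearbody m r.
  assert (Hfact :
    km * qb * (km * qc) / 1 ^ 2
    + f u * (Derive g u * qb + s * ka * pb) * (f u * (Derive g u * qc + s * ka * pc))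
      / (f u ^ 2) ^ 2
    = (s * ka * km * m * r / f u)
      * ((f u * km) ^ 2 + ka ^ 2 - Derive g u ^ 2)).
  { rewrite Hpc, Hqc, Hpb, Hqb.
    transitivity ((s * ka * km * m * r / f u)
      * ((f u * km) ^ 2 + (s * s) * ka ^ 2 - Derive g u ^ 2)); [field; lra|].
    rewrite Hs. ring. }
  rewrite Hfact. split; intros H.
  - apply Rmult_integral in H. destruct H as [H | H]; [exfalso | lra].
    revert H. unfold Rdiv.
    repeat apply Rmult_integral_contrapositive_currified; auto.
    apply Rinv_neq_0_compat. lra.
  - replace ((f u * km) ^ 2 + ka ^ 2 - Derive g u ^ 2) with 0 by lra. ring.
Qed.

Lemma adapted_frame_exists u v : I u -> J v ->
  mink (mean_curvature z u v) (mean_curvature z u v) <> 0 ->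
  adapted_normal_frame z
    (scal (/ pseudo_norm (mean_curvature z u v)) (mean_curvature z u v))
    (scal (/ sqrt (Rabs (P u ^ 2 - spherical_curvature l n v ^ 2)))
       (plus (scal (s * P u) (n v))
             (scal (spherical_curvature l n v) (meridian_normal u v)))) u v.
Proof.
  intros Iu Jv HH.
  pose proof (mer_curve _ _ _ _ _ _ _ _ data) as M.
  pose proof (mer_f_pos _ _ _ _ M u Iu) as Hf. pose proof (mer_s _ _ _ _ M) as Hs.
  pose proof (mean_curvature_normal z u v (meridian_orthogonal u v Iu Jv)) as NH.
  pose proof (spherical_normal_normal u v Iu Jv) as Nn.
  pose proof (meridian_normal_normal u v Iu Jv) as Nm.
  destruct (meridian_normal_products u v Iu Jv) as (Hmm & Hnm & Hnn).
  pose proof (meridian_mean_curvature u v _ Iu Jv Nn) as Hn.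
  pose proof (meridian_mean_curvature u v _ Iu Jv Nm) as Hm.
  pose proof (meridian_mean_curvature u v _ Iu Jv NH) as HHH.
  rewrite (mink_sym (meridian_normal u v) (n v)), Hnm, Hnn in Hn.
  rewrite Hmm, Hnm in Hm.
  rewrite (mink_sym (meridian_normal u v)), (mink_sym (n v)), Hn, Hm in HHH.
  set (H := mean_curvature z u v) in *.
  set (ka := spherical_curvature l n v) in *.
  assert (HP : P u ^ 2 - ka ^ 2 <> 0).
  { intros E. apply HH. rewrite HHH.
    transitivity (s * ((s * s) * ka ^ 2 - P u ^ 2) / (4 * f u ^ 2)); [field; lra|].
    rewrite Hs. replace (1 * ka ^ 2 - P u ^ 2) with 0 by lra. field. lra. }
  pose proof (Rabs_pos_lt _ HP) as HPa. pose proof (Rabs_pos_lt _ HH) as HHa.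
  pose proof (sqrt_lt_R0 _ HPa) as HPs. pose proof (sqrt_lt_R0 _ HHa) as HHs.
  pose proof (sqrt_sqrt _ (Rlt_le _ _ HPa)) as HPq.
  pose proof (sqrt_sqrt _ (Rlt_le _ _ HHa)) as HHq.
  assert (Hs1 : Rabs s = 1).
  { unfold Rabs. destruct (Rcase_abs s); nra. }
  destruct NH as [NH0 NH1], Nn as [Nn0 Nn1], Nm as [Nm0 Nm1].
  unfold adapted_normal_frame, pseudo_norm.
  rewrite !mink_scal_l, !mink_scal_r, !mink_plus_l, !mink_plus_r, !mink_scal_l,
    !mink_scal_r.
  rewrite NH0, NH1, Nn0, Nn1, Nm0, Nm1, Hn, Hm, (mink_sym (meridian_normal u v) (n v)),
    Hmm, Hnn, Hnm.
  set (D := sqrt (Rabs (P u ^ 2 - ka ^ 2))) in *.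
  set (h := sqrt (Rabs (mink H H))) in *.
  split; [|split; [|split; [|split; [|split; [|split; [|split]]]]]].
  - ring.
  - ring.
  - ring.
  - ring.
  - transitivity (P u * ka * s * (s * s - 1) / (h * D * (2 * f u))); [field; lra|].
    rewrite Hs. field. lra.
  - rewrite <- Rmult_assoc, Rabs_mult, <- HHq.
    rewrite Rabs_pos_eq; [field; lra|].
    apply Rmult_le_pos; apply Rlt_le, Rinv_0_lt_compat; assumption.
  - match goal with |- Rabs ?x = 1 =>
      replace x with (s * ((P u ^ 2 - ka ^ 2) / (D * D))) end.
    + rewrite Rabs_mult, Hs1. unfold Rdiv. rewrite Rabs_mult, <- HPq.
      rewrite Rabs_pos_eq; [field; lra|].
      apply Rlt_le, Rinv_0_lt_compat, Rmult_lt_0_compat; assumption.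
    + transitivity (s * ((s * s) * P u ^ 2 - ka ^ 2) / (D * D)).
      * rewrite Hs. field. lra.
      * field. lra.
  - exists h. apply R41_ext.
    + change (x1 H = h * (/ h * x1 H)). field. lra.
    + change (x2 H = h * (/ h * x2 H)). field. lra.
    + change (x3 H = h * (/ h * x3 H)). field. lra.
    + change (x4 H = h * (/ h * x4 H)). field. lra.
Qed.

Lemma meridian_Chen_iff :
  general_class I J f g l n -> non_null_mean_curvature I J z ->
  Chen_surface I J z <->
  (forall u v, I u -> J v ->
     Derive g u ^ 2
     = (f u * meridian_curvature f g u) ^ 2 + spherical_curvature l n v ^ 2).
Proof.
  intros Hgen HH. split.
  - intros (b & c & Hbc) u v Iu Jv. destruct (Hbc u v Iu Jv) as [Had Hal].
    apply (allied_mean_curvature_eq_zero_iff (b u v) (c u v)); auto.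
  - intros E. eexists. eexists. intros u v Iu Jv.
    pose proof (adapted_frame_exists u v Iu Jv (HH u v Iu Jv)) as Had.
    split; [exact Had|].
    apply (allied_mean_curvature_eq_zero_iff _ _ u v); auto.
Qed.

End MeridianSurface.

(** * The meridians of Chen surfaces *)

Lemma ex_derive_curvature_term s I f g u : meridian_curve s I f g -> I u ->
  ex_derive (fun r => f r * meridian_curvature f g r) u.
Proof.
  intros M Iu.
  pose proof (mer_f_smooth _ _ _ _ M) as Sf. pose proof (mer_g_smooth _ _ _ _ M) as Sg.
  apply ex_derive_mult; [eexists; exact (smooth_is_derive I f u Sf Iu)|].
  apply (ex_derive_minus (V := R_NormedModule)); apply ex_derive_mult; eexists.
  - exact (smooth_is_derive_Derive I f u Sf Iu).
  - exact (smooth_is_derive_Derive_n_2 I g u Sg Iu).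
  - exact (smooth_is_derive_Derive I g u Sg Iu).
  - exact (smooth_is_derive_Derive_n_2 I f u Sf Iu).
Qed.

(** With [p = f kappa_m], differentiating [g' ^ 2 - p ^ 2 = b ^ 2] and the Frenet
    equation for [g''] give [f p' = f' g']; together with [f g'' = f' p] this says
    that [p + g'] is a constant multiple [C f] of [f].  The other factor of
    [b ^ 2 = (g' + p) (g' - p)] is then [b ^ 2 / (C f)], and the sum of the two
    factors is [2 g']. *)
Lemma Chen_meridian_first_integral s I f g b :
  meridian_curve s I f g -> b <> 0 -> (forall u, I u -> meridian_curvature f g u <> 0) ->
  (forall u, I u -> Derive g u ^ 2 = (f u * meridian_curvature f g u) ^ 2 + b ^ 2) ->
  exists C, 0 < C /\ forall u, I u -> 2 * C * f u * Derive g u = C ^ 2 * f u ^ 2 + b ^ 2.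
Proof.
  intros M Hb Hkm HC. pose proof (mer_I _ _ _ _ M) as HI.
  set (p := fun r => f r * meridian_curvature f g r).
  assert (HC' : forall u, I u -> Derive g u ^ 2 - p u ^ 2 = b ^ 2).
  { intros u Iu. unfold p. rewrite (HC u Iu). ring. }
  assert (Hder : forall u, I u -> is_derive (fun r => (p r + Derive g r) / f r) u 0).
  { intros u Iu. pose proof (mer_f_pos _ _ _ _ M u Iu) as Hf.
    pose proof (smooth_is_derive I f u (mer_f_smooth _ _ _ _ M) Iu) as Df.
    pose proof (smooth_is_derive_Derive I g u (mer_g_smooth _ _ _ _ M) Iu) as Dg.
    destruct (ex_derive_curvature_term s I f g u M Iu) as [p1 Dp]. fold p in Dp.
    destruct (meridian_frenet s I f g u M Iu) as [_ G2].
    assert (D : is_derive (fun r => Derive g r ^ 2 - p r ^ 2) u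
                  (2 * Derive g u * Derive_n g 2 u - 2 * p u * p1)).
    { evar_last.
      - apply (is_derive_minus (V := R_NormedModule));
          apply is_derive_pow; [exact Dg | exact Dp].
      - unfold minus, plus, opp; cbn. ring. }
    pose proof (is_derive_of_constant_on I _ _ u _ HI HC' Iu D) as E.
    assert (Hp1 : f u * p1 = Derive f u * Derive g u).
    { apply Rmult_eq_reg_l with (meridian_curvature f g u); [|apply Hkm, Iu].
      transitivity (p u * p1); [unfold p; ring|].
      transitivity (Derive g u * Derive_n g 2 u); [lra|]. rewrite G2. ring. }
    evar_last.
    - apply is_derive_div; [|exact Df|lra].
      apply (is_derive_plus (V := R_NormedModule)); [exact Dp | exact Dg].
    - unfold plus.
      rewrite G2. cbn.
      apply Rmult_eq_reg_r with (f u ^ 2); [|apply pow_nonzero; lra].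
      transitivity (f u * p1 + meridian_curvature f g u * Derive f u * f u
                    - (p u + Derive g u) * Derive f u); [field; lra|].
      rewrite Hp1. unfold p. ring. }
  destruct HI as [Hconv (u0 & u1 & Iu0 & _)].
  set (C := (p u0 + Derive g u0) / f u0).
  assert (HCf : forall u, I u -> p u + Derive g u = C * f u).
  { intros u Iu. pose proof (mer_f_pos _ _ _ _ M u Iu).
    unfold C. rewrite (is_derive_zero_constant I _ u0 u (mer_I _ _ _ _ M) Hder Iu0 Iu).
    field. lra. }
  assert (Hint : forall u, I u -> 2 * C * f u * Derive g u = C ^ 2 * f u ^ 2 + b ^ 2).
  { intros u Iu. rewrite <- (HC' u Iu).
    transitivity (2 * (C * f u) * Derive g u); [ring|].
    transitivity ((C * f u) ^ 2 + (Derive g u ^ 2 - p u ^ 2)); [|ring].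
    rewrite <- (HCf u Iu). ring. }
  exists C. split; [|exact Hint].
  pose proof (mer_f_pos _ _ _ _ M u0 Iu0). pose proof (mer_g_sign _ _ _ _ M u0 Iu0).
  pose proof (Hint u0 Iu0). assert (0 < b ^ 2) by nra.
  destruct (Rlt_le_dec 0 C) as [|Hneg]; [assumption|exfalso].
  assert (0 <= f u0 * Derive g u0) by nra. nra.
Qed.

(** The argument can be reversed where [f' <> 0]: the derivative of the relation is
    [f'] times a nonzero multiple of [f kappa_m + g' - C f]. *)
Lemma first_integral_Chen_meridian s I K f g b C u :
  meridian_curve s I f g -> interval K -> (forall r, K r -> I r) -> K u ->
  Derive f u <> 0 -> 0 < C ->
  (forall r, K r -> 2 * C * f r * Derive g r = C ^ 2 * f r ^ 2 + b ^ 2) ->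
  Derive g u ^ 2 = (f u * meridian_curvature f g u) ^ 2 + b ^ 2.
Proof.
  intros M HK HKI Ku Hf1 HC Hint. pose proof (HKI u Ku) as Iu.
  pose proof (smooth_is_derive I f u (mer_f_smooth _ _ _ _ M) Iu) as Df.
  pose proof (smooth_is_derive_Derive I g u (mer_g_smooth _ _ _ _ M) Iu) as Dg.
  destruct (meridian_frenet s I f g u M Iu) as [_ G2].
  assert (D : is_derive (fun r => 2 * C * (f r * Derive g r) - C ^ 2 * f r ^ 2) u
            (2 * C * (Derive f u * Derive g u + f u * Derive_n g 2 u)
             - C ^ 2 * (2 * f u * Derive f u))).
  { evar_last.
    - apply (is_derive_minus (V := R_NormedModule)); apply is_derive_scal.
      + exact (is_derive_mult _ _ _ _ _ Df Dg Rmult_comm).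
      + apply is_derive_pow. exact Df.
    - unfold minus, plus, opp, mult; cbn. ring. }
  assert (Hconst : forall r, K r ->
            2 * C * (f r * Derive g r) - C ^ 2 * f r ^ 2 = b ^ 2).
  { intros r Kr. specialize (Hint r Kr). lra. }
  pose proof (is_derive_of_constant_on K _ _ u _ HK Hconst Ku D) as E.
  rewrite G2 in E.
  assert (E' : 2 * C * Derive f u *
            (f u * meridian_curvature f g u + Derive g u - C * f u) = 0)
    by (rewrite <- E; ring).
  apply Rmult_integral in E'. destruct E' as [E' | E'].
  { exfalso. revert E'. repeat apply Rmult_integral_contrapositive_currified; lra. }
  assert (Hp : f u * meridian_curvature f g u = C * f u - Derive g u) by lra.
  rewrite Hp. specialize (Hint u Ku). lra.
Qed.

(** The common form of [y_elliptic] ([s = 1]) and [y_hyperbolic] ([s = -1]). *)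
Definition meridian_slope (s : R) (eps : Z) (a b t : R) : R :=
  IZR eps / (2 * powerRZ t eps) *
  sqrt (4 * powerRZ t (2 * eps) - s * a * (powerRZ t (2 * eps) - b ^ 2 / a) ^ 2).

Lemma meridian_slope_plus s a b t :
  meridian_slope s 1 a b t
  = / (2 * t) * sqrt (4 * t ^ 2 - s * a * (t ^ 2 - b ^ 2 / a) ^ 2).
Proof.
  unfold meridian_slope. change (2 * 1)%Z with 2%Z.
  change (powerRZ t 2) with (t ^ 2). rewrite powerRZ_1. unfold Rdiv. ring.
Qed.

Lemma meridian_slope_minus s a b t : 0 < t ->
  meridian_slope s (-1) a b t
  = - (t / 2) * sqrt (4 / t ^ 2 - s * a * (/ t ^ 2 - b ^ 2 / a) ^ 2).
Proof.
  intros Ht. unfold meridian_slope. change (2 * -1)%Z with (-2)%Z.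
  change (powerRZ t (-2)) with (/ t ^ 2). change (powerRZ t (-1)) with (/ (t * 1)).
  unfold Rdiv. replace (-1 * / (2 * / (t * 1))) with (- (t * / 2)) by (field; lra).
  reflexivity.
Qed.

(** The relation reads [2 w = C t + b ^ 2 / (C t)].  Exchanging the two terms of
    the sum turns the upper signs with [a = - C ^ 2] into the lower signs with
    [a = - b ^ 4 / C ^ 2], so both choices of the signs describe the same values
    of [d ^ 2 = 1 + s w ^ 2] and differ by the sign of [d]. *)
Lemma meridian_slope_of_first_integral s b C t d w :
  0 < t -> 0 < C -> d ^ 2 - s * w ^ 2 = 1 ->
  2 * C * t * w = C ^ 2 * t ^ 2 + b ^ 2 -> b <> 0 ->
  (0 < d -> d = meridian_slope s 1 (- C ^ 2) b t) /\
  (d < 0 -> d = meridian_slope s (-1) (- (b ^ 4 / C ^ 2)) b t).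
Proof.
  intros Ht HC Hd Hw Hb.
  assert (Hw' : w = (C ^ 2 * t ^ 2 + b ^ 2) / (2 * C * t)).
  { rewrite <- Hw. field. lra. }
  split; intros Hs.
  - rewrite meridian_slope_plus.
    replace (4 * t ^ 2 - s * - C ^ 2 * (t ^ 2 - b ^ 2 / - C ^ 2) ^ 2)
      with ((2 * t * d) * (2 * t * d)).
    + rewrite sqrt_square by nra. field. lra.
    + transitivity (4 * t ^ 2 * (1 + s * w ^ 2)); [rewrite <- Hd; ring|].
      rewrite Hw'. field. lra.
  - rewrite meridian_slope_minus by assumption.
    replace (4 / t ^ 2 - s * - (b ^ 4 / C ^ 2) * (/ t ^ 2 - b ^ 2 / - (b ^ 4 / C ^ 2)) ^ 2)
      with ((2 * - d / t) * (2 * - d / t)).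
    + rewrite sqrt_square; [field; lra|].
      apply Rmult_le_pos; [lra | apply Rlt_le, Rinv_0_lt_compat, Ht].
    + transitivity (4 / t ^ 2 * (1 + s * w ^ 2)); [rewrite <- Hd; field; lra|].
      rewrite Hw'. field. lra.
Qed.

(** As [d <> 0], the square root is not the value [0] that it takes at negative
    numbers, and the equation can be squared.  The constant [a1] is [a] for the
    upper signs and [b ^ 4 / a] for the lower ones. *)
Lemma quadratic_relation_of_meridian_slope s eps a b :
  s * s = 1 -> b <> 0 -> a <> 0 -> (eps = 1 \/ eps = -1)%Z ->
  exists a1, a1 <> 0 /\ forall t d w,
    0 < t -> d <> 0 -> d ^ 2 - s * w ^ 2 = 1 -> d = meridian_slope s eps a b t ->
    4 * a1 * t ^ 2 * w ^ 2 = - (a1 * t ^ 2 - b ^ 2) ^ 2.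
Proof.
  intros Hs Hb Ha Heps.
  assert (Hsq : forall k rad d, d <> 0 -> d = k * sqrt rad -> d ^ 2 = k ^ 2 * rad).
  { intros k rad d Hd Hk. destruct (Rle_lt_dec rad 0) as [Hr | Hr].
    - exfalso. apply Hd. rewrite Hk, sqrt_neg_0 by assumption. ring.
    - rewrite Hk, Rpow_mult_distr, pow2_sqrt by lra. reflexivity. }
  destruct Heps as [-> | ->].
  - exists a. split; [assumption|]. intros t d w Ht Hd Hdw Hy.
    rewrite meridian_slope_plus in Hy. apply Hsq in Hy; [|assumption].
    assert (Hw : s * w ^ 2 = - s * a * (t ^ 2 - b ^ 2 / a) ^ 2 / (4 * t ^ 2)).
    { transitivity (d ^ 2 - 1); [lra|]. rewrite Hy. field. lra. }
    transitivity (4 * a * t ^ 2 * (s * (s * w ^ 2)));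
      [rewrite <- Rmult_assoc with (r1 := s), Hs; ring|].
    rewrite Hw. transitivity (- (s * s) * (a * t ^ 2 - b ^ 2) ^ 2); [field; lra|].
    rewrite Hs. ring.
  - exists (b ^ 4 / a). split.
    { apply Rmult_integral_contrapositive_currified;
        [apply pow_nonzero | apply Rinv_neq_0_compat]; assumption. }
    intros t d w Ht Hd Hdw Hy.
    rewrite meridian_slope_minus in Hy by assumption. apply Hsq in Hy; [|assumption].
    assert (Hw : s * w ^ 2 = - s * a * (/ t ^ 2 - b ^ 2 / a) ^ 2 * t ^ 2 / 4).
    { transitivity (d ^ 2 - 1); [lra|]. rewrite Hy. field. lra. }
    transitivity (4 * (b ^ 4 / a) * t ^ 2 * (s * (s * w ^ 2)));
      [rewrite <- Rmult_assoc with (r1 := s), Hs; ring|].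
    rewrite Hw.
    transitivity (- (s * s) * (b ^ 4 / a * t ^ 2 - b ^ 2) ^ 2); [field; lra|].
    rewrite Hs. ring.
Qed.

(** For [a1 > 0] the quadratic relation equates a nonnegative and a nonpositive
    number; then [a1 f ^ 2 = b ^ 2] and [f] is constant.  So [a1 = - C ^ 2], and as
    [g' >= 0] the square root of the relation can be taken. *)
Lemma meridian_slope_iff_first_integral s I K f g b :
  meridian_curve s I f g -> b <> 0 -> interval K -> (forall u, K u -> I u) ->
  (forall u, K u -> Derive f u <> 0) ->
  meridian_determined_by (meridian_slope s) b K f <->
  exists C, 0 < C /\ forall u, K u -> 2 * C * f u * Derive g u = C ^ 2 * f u ^ 2 + b ^ 2.
Proof.
  intros M Hb HK HKI Hf1.
  assert (Harc : forall u, K u -> Derive f u ^ 2 - s * Derive g u ^ 2 = 1).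
  { intros u Ku. apply (mer_arclength _ _ _ _ M), HKI, Ku. }
  assert (Hpos : forall u, K u -> 0 < f u).
  { intros u Ku. apply (mer_f_pos _ _ _ _ M), HKI, Ku. }
  split.
  - intros (eps & a & Heps & Ha & Hy).
    destruct (quadratic_relation_of_meridian_slope s eps a b (mer_s _ _ _ _ M) Hb Ha Heps)
      as (a1 & Ha1 & Hquad).
    assert (Hq : forall u, K u -> 4 * a1 * f u ^ 2 * Derive g u ^ 2
                                  = - (a1 * f u ^ 2 - b ^ 2) ^ 2).
    { intros u Ku. apply (Hquad (f u) (Derive f u)); auto. }
    assert (Hneg : a1 < 0).
    { destruct (Rlt_le_dec a1 0) as [|Hle]; [assumption|exfalso].
      assert (Hconst : forall u, K u -> f u ^ 2 = b ^ 2 / a1).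
      { intros u Ku. specialize (Hq u Ku).
        pose proof (pow2_ge_0 (f u * Derive g u)) as S1.
        pose proof (pow2_ge_0 (a1 * f u ^ 2 - b ^ 2)) as S2.
        assert (0 <= a1 * (f u * Derive g u) ^ 2) by (apply Rmult_le_pos; assumption).
        assert (E : (a1 * f u ^ 2 - b ^ 2) ^ 2 = 0) by lra.
        assert (E' : a1 * f u ^ 2 - b ^ 2 = 0) by nra.
        apply Rmult_eq_reg_l with a1; [|assumption].
        transitivity (b ^ 2); [lra|]. field. assumption. }
      destruct HK as [HKc (u & u' & Ku & HK')].
      pose proof (is_derive_pow f 2 u _
                    (smooth_is_derive I f u (mer_f_smooth _ _ _ _ M) (HKI u Ku))) as D.
      apply (is_derive_of_constant_on K _ _ u _
        (conj HKc (ex_intro _ u (ex_intro _ u' (conj Ku HK')))) Hconst Ku) in D.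
      pose proof (Hf1 u Ku) as H1. pose proof (Hpos u Ku) as H2. cbn in D.
      apply H1. nra. }
    exists (sqrt (- a1)).
    assert (HC : 0 < sqrt (- a1)) by (apply sqrt_lt_R0; lra).
    split; [exact HC|]. intros u Ku.
    pose proof (pow2_sqrt (- a1) ltac:(lra)) as HC2.
    pose proof (Hpos u Ku) as Hf. pose proof (mer_g_sign _ _ _ _ M u (HKI u Ku)) as Hg.
    apply Rsqr_inj.
    + repeat apply Rmult_le_pos; lra.
    + pose proof (pow2_ge_0 (sqrt (- a1) * f u)). pose proof (pow2_ge_0 b). nra.
    + unfold Rsqr.
      transitivity (4 * sqrt (- a1) ^ 2 * f u ^ 2 * Derive g u ^ 2); [ring|].
      rewrite HC2. specialize (Hq u Ku). lra.
  - intros (C & HC & Hint).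
    assert (HCa : 0 < b ^ 4 / C ^ 2).
    { apply Rmult_lt_0_compat; [|apply Rinv_0_lt_compat, pow_lt, HC].
      assert (0 < b ^ 2) by nra. nra. }
    destruct (nonvanishing_constant_sign K (Derive f) HK) as [Hs | Hs]; auto.
    + intros u Ku. eexists.
      exact (smooth_is_derive_Derive I f u (mer_f_smooth _ _ _ _ M) (HKI u Ku)).
    + exists 1%Z, (- C ^ 2). split; [tauto|]. split; [nra|]. intros u Ku.
      apply (meridian_slope_of_first_integral s b C (f u) (Derive f u) (Derive g u)); auto.
    + exists (-1)%Z, (- (b ^ 4 / C ^ 2)). split; [tauto|]. split; [lra|]. intros u Ku.
      apply (meridian_slope_of_first_integral s b C (f u) (Derive f u) (Derive g u)); auto.
Qed.

Lemma meridian_determined_ext y y' b K f :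
  (forall eps a t, y eps a b t = y' eps a b t) ->
  meridian_determined_by y b K f <-> meridian_determined_by y' b K f.
Proof.
  intros E. split; intros (eps & a & Heps & Ha & H); exists eps, a;
    (split; [assumption|split; [assumption|]]); intros u Ku;
    [rewrite <- E | rewrite E]; auto.
Qed.

Lemma y_elliptic_meridian_slope eps a b t : y_elliptic eps a b t = meridian_slope 1 eps a b t.
Proof. unfold y_elliptic, meridian_slope. rewrite Rmult_1_l. reflexivity. Qed.

Lemma y_hyperbolic_meridian_slope eps a b t :
  y_hyperbolic eps a b t = meridian_slope (-1) eps a b t.
Proof. unfold y_hyperbolic, meridian_slope. f_equal. f_equal. ring. Qed.

(** Only [kappa] depends on [v], so [kappa ^ 2] is constant; a differentiable
    function whose square is a nonzero constant has derivative [0]. *)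
Lemma Chen_constant_spherical_curvature s e I J f g l n :
  meridian_data s e I J f g l n -> general_class I J f g l n ->
  (forall u v, I u -> J v ->
     Derive g u ^ 2 = (f u * meridian_curvature f g u) ^ 2 + spherical_curvature l n v ^ 2)
  <-> exists b, b <> 0 /\ (forall v, J v -> spherical_curvature l n v = b) /\
      forall u, I u -> Derive g u ^ 2 = (f u * meridian_curvature f g u) ^ 2 + b ^ 2.
Proof.
  intros D Hgen. pose proof (mer_J _ _ _ _ _ _ _ _ D) as HJ.
  destruct (mer_I _ _ _ _ (mer_curve _ _ _ _ _ _ _ _ D)) as [_ (u0 & _ & Iu0 & _)].
  pose proof HJ as [_ (v0 & _ & Jv0 & _)].
  split.
  - intros H. exists (spherical_curvature l n v0).
    assert (Hnz : forall v, J v -> spherical_curvature l n v <> 0).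
    { intros v Jv E. apply (Hgen u0 v Iu0 Jv). rewrite E. ring. }
    split; [auto|]. split; [|auto].
    assert (Hd : forall v, J v -> is_derive (spherical_curvature l n) v 0).
    { intros v Jv.
      destruct (smooth_curve_differentiable J l v (mer_l_smooth _ _ _ _ _ _ _ _ D) Jv)
        as (_ & _ & Da).
      destruct (smooth_curve_differentiable J n v (mer_n_smooth _ _ _ _ _ _ _ _ D) Jv)
        as (Dn & _).
      pose proof (is_derive_mink _ _ v Da Dn) as Hk.
      change (is_derive (spherical_curvature l n) v
        (mink (Dcurve (Dcurve (Dcurve l)) v) (n v)
         + mink (Dcurve (Dcurve l) v) (Dcurve n v))) in Hk.
      revert Hk. generalize (mink (Dcurve (Dcurve (Dcurve l)) v) (n v)
         + mink (Dcurve (Dcurve l) v) (Dcurve n v)). intros k1 Hk.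
      assert (Hc : forall r, J r ->
                spherical_curvature l n r ^ 2 = spherical_curvature l n v0 ^ 2).
      { intros r Jr. pose proof (H u0 r Iu0 Jr). pose proof (H u0 v0 Iu0 Jv0). lra. }
      pose proof (is_derive_of_constant_on J _ _ v _ HJ Hc Jv (is_derive_pow _ 2 v _ Hk))
        as E.
      pose proof (Hnz v Jv) as Hv. cbn in E.
      replace 0 with k1; [exact Hk|].
      assert (E' : spherical_curvature l n v * k1 = 0) by lra.
      apply Rmult_integral in E'. tauto. }
    intros v Jv. exact (is_derive_zero_constant J _ v v0 HJ Hd Jv Jv0).
  - intros (b & _ & Hb & H) u v Iu Jv. rewrite (Hb v Jv). auto.
Qed.

(** The zeros of [f'] are isolated, because [f'' = s kappa_m g'] does not vanish
    there, and both sides of the identity are continuous. *)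
Lemma Chen_meridian_of_nonzero_slope s I f g b :
  meridian_curve s I f g -> (forall u, I u -> meridian_curvature f g u <> 0) ->
  (forall u, I u -> Derive f u <> 0 ->
     Derive g u ^ 2 = (f u * meridian_curvature f g u) ^ 2 + b ^ 2) ->
  forall u, I u -> Derive g u ^ 2 = (f u * meridian_curvature f g u) ^ 2 + b ^ 2.
Proof.
  intros M Hkm H u Iu.
  destruct (Req_dec (Derive f u) 0) as [Hf1 | Hf1]; [|auto].
  pose proof (smooth_is_derive_Derive I f u (mer_f_smooth _ _ _ _ M) Iu) as Df.
  destruct (meridian_frenet s I f g u M Iu) as [F2 _].
  pose proof (mer_arclength _ _ _ _ M u Iu) as A. rewrite Hf1 in A.
  assert (H2 : Derive_n f 2 u <> 0).
  { rewrite F2. repeat apply Rmult_integral_contrapositive_currified.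
    - intros E. rewrite E in A. lra.
    - auto.
    - intros E. rewrite E in A. lra. }
  destruct (simple_zero_isolated (Derive f) u _ Df Hf1 H2) as (d1 & Hd1 & Hnz).
  set (F := fun r => Derive g r ^ 2 - (f r * meridian_curvature f g r) ^ 2).
  assert (HF : ex_derive F u).
  { destruct (ex_derive_curvature_term s I f g u M Iu) as [p1 Dp].
    pose proof (smooth_is_derive_Derive I g u (mer_g_smooth _ _ _ _ M) Iu) as Dg.
    apply (ex_derive_minus (V := R_NormedModule)); eexists; apply is_derive_pow;
      [exact Dg | exact Dp]. }
  destruct (Req_dec (F u) (b ^ 2)) as [E | E]; [unfold F in E; lra | exfalso].
  destruct (ex_derive_near_neq F (b ^ 2) u HF E) as (d2 & Hd2 & HFnz).
  destruct (interval_near I u (Rmin d1 d2) (mer_I _ _ _ _ M) Iu (Rmin_pos _ _ Hd1 Hd2))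
    as (k & Hk0 & Hk & Ik).
  pose proof (Rmin_l d1 d2). pose proof (Rmin_r d1 d2).
  apply (HFnz (u + k)); [replace (u + k - u) with k by ring; lra|].
  unfold F. rewrite (H (u + k) Ik); [ring|]. apply Hnz; [assumption|lra].
Qed.

Theorem theorem7p1
  (I J : R -> Prop) (f g : R -> R) (l n : R -> R41) :
  (elliptic_data I J f g l n ->
   general_class I J f g l n ->
   non_null_mean_curvature I J (elliptic_meridian_surface f g l) ->
   (Chen_surface I J (elliptic_meridian_surface f g l) <->
    exists b : R, b <> 0 /\
      (forall v, J v -> spherical_curvature l n v = b) /\
      meridian_determined_by y_elliptic b I f /\
      (forall u, I u -> Derive g u = sqrt (Derive f u ^ 2 - 1)))) /\
  (hyperbolic_data I J f g l n ->
   general_class I J f g l n ->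
   non_null_mean_curvature I J (hyperbolic_meridian_surface f g l) ->
   (Chen_surface I J (hyperbolic_meridian_surface f g l) <->
    exists b : R, b <> 0 /\
      (forall v, J v -> spherical_curvature l n v = b) /\
      meridian_piecewise_determined_by y_hyperbolic b I f /\
      (forall u, I u -> Derive g u = sqrt (1 - Derive f u ^ 2)))).
Proof.
  assert (Hkm : general_class I J f g l n -> (exists v, J v) ->
                forall u, I u -> meridian_curvature f g u <> 0).
  { intros Hgen [v Jv] u Iu E. apply (Hgen u v Iu Jv). rewrite E. ring. }
  split; intros data Hgen HH.
  - pose proof (elliptic_meridian_data _ _ _ _ _ _ data) as D.
    pose proof (mer_curve _ _ _ _ _ _ _ _ D) as M.
    pose proof (mer_I _ _ _ _ M) as HI.
    destruct (mer_J _ _ _ _ _ _ _ _ D) as [_ (v0 & _ & Jv0 & _)].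
    specialize (Hkm Hgen (ex_intro _ v0 Jv0)).
    assert (Hf1 : forall u, I u -> Derive f u <> 0).
    { intros u Iu E. pose proof (mer_arclength _ _ _ _ M u Iu) as A.
      rewrite E in A. pose proof (pow2_ge_0 (Derive g u)). lra. }
    pose proof (fun b Hb => meridian_slope_iff_first_integral 1 I I f g b M Hb HI
                  (fun u Iu => Iu) Hf1) as Hslope.
    change (elliptic_meridian_surface f g l) with (meridian_surface e4 f g l) in *.
    rewrite (meridian_Chen_iff 1 e4 I J f g l n D Hgen HH).
    rewrite (Chen_constant_spherical_curvature 1 e4 I J f g l n D Hgen).
    split.
    + intros (b & Hb & Hk & HC). exists b.
      split; [assumption|]. split; [assumption|]. split; [|apply data].
      rewrite (meridian_determined_ext _ _ b I f
        (fun eps a t => y_elliptic_meridian_slope eps a b t)), Hslope by assumption.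
      exact (Chen_meridian_first_integral 1 I f g b M Hb Hkm HC).
    + intros (b & Hb & Hk & Hdet & _). exists b.
      split; [assumption|]. split; [assumption|].
      rewrite (meridian_determined_ext _ _ b I f
        (fun eps a t => y_elliptic_meridian_slope eps a b t)), Hslope in Hdet by assumption.
      destruct Hdet as (C & HC & Hint). intros u Iu.
      exact (first_integral_Chen_meridian 1 I I f g b C u M HI (fun r Ir => Ir) Iu
               (Hf1 u Iu) HC Hint).
  - pose proof (hyperbolic_meridian_data _ _ _ _ _ _ data) as D.
    pose proof (mer_curve _ _ _ _ _ _ _ _ D) as M.
    pose proof (mer_I _ _ _ _ M) as HI.
    destruct (mer_J _ _ _ _ _ _ _ _ D) as [_ (v0 & _ & Jv0 & _)].
    specialize (Hkm Hgen (ex_intro _ v0 Jv0)).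
    pose proof (fun K b Hb => meridian_slope_iff_first_integral (-1) I K f g b M Hb)
      as Hslope.
    change (hyperbolic_meridian_surface f g l) with (meridian_surface e1 f g l) in *.
    rewrite (meridian_Chen_iff (-1) e1 I J f g l n D Hgen HH).
    rewrite (Chen_constant_spherical_curvature (-1) e1 I J f g l n D Hgen).
    split.
    + intros (b & Hb & Hk & HC). exists b.
      split; [assumption|]. split; [assumption|]. split; [|apply data].
      intros K HK HKI Hf1.
      rewrite (meridian_determined_ext _ _ b K f
        (fun eps a t => y_hyperbolic_meridian_slope eps a b t)), Hslope by assumption.
      destruct (Chen_meridian_first_integral (-1) I f g b M Hb Hkm HC) as (C & HCp & Hint).
      exists C. auto.
    + intros (b & Hb & Hk & Hdet & _). exists b.
      split; [assumption|]. split; [assumption|].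
      apply (Chen_meridian_of_nonzero_slope (-1) I f g b M Hkm).
      intros u Iu Hf1.
      assert (Df : ex_derive (Derive f) u)
        by (eexists; exact (smooth_is_derive_Derive I f u (mer_f_smooth _ _ _ _ M) Iu)).
      destruct (ex_derive_near_neq (Derive f) 0 u Df Hf1) as (d & Hd & Hnz).
      set (K := fun x => I x /\ Rabs (x - u) < d).
      assert (HK : interval K) by exact (interval_neighbourhood I u d HI Iu Hd).
      assert (HKI : forall r, K r -> I r) by (intros r Kr; apply Kr).
      assert (HKf : forall r, K r -> Derive f r <> 0) by (intros r Kr; apply Hnz, Kr).
      assert (Ku : K u) by (split; [|rewrite Rminus_diag, Rabs_R0]; assumption).
      specialize (Hdet K HK HKI HKf).
      rewrite (meridian_determined_ext _ _ b K f
        (fun eps a t => y_hyperbolic_meridian_slope eps a b t)), Hslope in Hdet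
        by assumption.
      destruct Hdet as (C & HC & Hint).
      exact (first_integral_Chen_meridian (-1) I K f g b C u M HK HKI Ku Hf1 HC Hint).
Qed.
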